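(* The indexed preorder $T$ and the tripos induced by the modification $\mathrm{PER}(K_1)^m$ of the arrow algebra $\mathrm{PER}(K_1)$ are equivalent as indexed preorders. Hence $T$ is also a tripos.
   Context: For $m,n\in\mathbb N$ write $mn$ for the result, if defined, of applying the $m$-th partial recursive function to $n$. $\mathrm{PER}(K_1)$ is the set of symmetric and transitive binary relations on $\mathbb N$, ordered by inclusion, with implication $$R\to S:=\{(x,x')\in\mathbb N^2:\forall(y,y')\in R\ (xy\text{ and }x'y'\text{ are defined and }(xy,x'y')\in S)\}$$ and separator the set of inhabited such relations. This is an arrow algebra and it is binary implicative (definitions below). The indexed preorder $T$. Let $\Sigma_T:=\{(R,S)\in\mathrm{PER}(K_1)^2:R\subseteq S,\ (0,0)\in S\}$. The functor $T:\mathbf{Set}^{\rm op}\to\mathbf{Preorder}$ sends a set $I$ to the set of functions $\alpha=(\alpha_0,\alpha_1):I\to\Sigma_T$, preordered by: $\alpha\leq_{TI}\beta$ iff there is $r\in\mathbb N$ such that for all $i\in I$, $(r,r)\in(\alpha_0(i)\to\beta_0(i))\cap(\alpha_1(i)\to\beta_1(i))$. On morphisms $T$ acts by precomposition. Arrow algebras. An arrow structure is a complete poset $(A,\preccurlyeq)$ (infima $\bigwedge$, binary $\curlywedge$, least element $\bot$, greatest element $\top$) with a binary operation $\to$ such that $a'\preccurlyeq a$ and $b\preccurlyeq b'$ imply $a\to b\preccurlyeq a'\to b'$. The operation $\to$ associates to the right and binds stronger than $\bigwedge,\curlywedge$. A separator is a subset $S\subseteq A$ that is upwards closed, closed under modus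 ponens ($a\to b\in S$ and $a\in S$ imply $b\in S$), and contains $\mathbf k=\bigwedge_{a,b}a\to b\to a$, $\mathbf s=\bigwedge_{a,b,c}(a\to b\to c)\to(a\to b)\to(a\to c)$ and $\mathbf a=\bigwedge_{a\in A,\,B\subseteq\mathrm{Im}(\to)}(\bigwedge_{b\in B}a\to b)\to a\to\bigwedge_{b\in B}b$. An arrow algebra is an arrow structure with a separator. It is binary implicative if $a\to(b\curlywedge b')=(a\to b)\curlywedge(a\to b')$ always. For a binary implicative arrow algebra $A$ with separator $S$, the arrow algebra $A^\to$ has underlying set $\{(x_0,x_1)\in A^2:x_0\preccurlyeq x_1\}$ with the pointwise order, implication $x\to y:=((x_0\to y_0)\curlywedge(x_1\to y_1),\,x_1\to y_1)$, and separator $S^\to=\{x\in A^\to:x_0\in S\}$. In an arrow algebra, $a\lor b$ denotes the join in the logical preorder ($a\vdash b$ iff $a\to b\in S$), represented by $a\lor b:=\bigwedge_c(a\to c)\to(b\to c)\to c$. A nucleus on an arrow algebra is a $\preccurlyeq$-monotone map $j$ with $\bigwedge_a a\to ja\in S$ and $\bigwedge_{a,b}(a\to jb)\to(ja\to jb)\in S$. For a nucleus $j$ on an arrow algebra $C$ with separator $S$, $C_j$ is the arrow algebra with the same underlying poset, implication $a\to_j b:=a\to jb$ and separator $S_j=\{a:ja\in S\}$. The modification of a binary implicative arrow algebra $A$ is $A^m:=(A^\to)_j$, where $j$ is the nucleus $j(x)=x\lor(\bot,\top)$ on $A^\to$. The tripos induced by an arrow algebra $(A,\preccurlyeq,\to,S)$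 sends a set $I$ to $A^I$ preordered by $\varphi\vdash\psi$ iff $\bigwedge_{i\in I}\varphi(i)\to\psi(i)\in S$, and acts on functions by precomposition. A ($\mathbf{Set}$-based) tripos is a pseudofunctor $P:\mathbf{Set}^{\rm op}\to\mathbf{preHeyt}$ (preorders whose poset reflection is a Heyting algebra, with monotone maps preserving finite meets, finite joins and implication up to isomorphism) such that every $Pf$ has a left adjoint $\exists_f$ and a right adjoint $\forall_f$ in preorders satisfying the Beck–Chevalley condition for pullback squares of sets, and there are a set $\Sigma$ and $\sigma\in P\Sigma$ such that every $\varphi\in PI$ is isomorphic to $P[\varphi](\sigma)$ for some function $[\varphi]:I\to\Sigma$. Two indexed preorders $\mathbf{Set}^{\rm op}\to\mathbf{Preorder}$ are equivalent if there are (pseudo)natural transformations in both directions which are mutually inverse up to isomorphism. In the presence of the axiom of choice, it is equivalent to ask for one (pseudo)natural transformation that pointwise preserves and reflects the preorder and is essentially surjective. *)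

(* Defs.v *)
From Stdlib Require Import Relation_Definitions Arith Cantor Lia.
From Stdlib Require Import FunctionalExtensionality PropExtensionality ProofIrrelevance.

(* The partial recursive functions of one argument, presented as the least class
   containing zero, successor and the two projections of a pairing bijection
   [nat * nat -> nat] and closed under pairing, composition, primitive recursion
   (with one parameter) and unbounded minimisation.  Functions of several arguments
   are coded by means of the Cantor pairing. *)
Inductive code : Set :=
| Zero : code
| Succ : code
| Left : code
| Right : code
| Pair : code -> code -> code
| Comp : code -> code -> code
| Prec : code -> code -> code
| Mu : code -> code.

(* [eval c x z]: the partial function [c] is defined at [x] with value [z].
   - [Prec f g] sends <a, 0> to f a, and <a, n + 1> to g <a, <n, Prec f g <a, n>>>;
   - [Mu f] sends a to the least n such that f <a, n> = 0, all the values f <a, k>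
     with k < n being defined and nonzero. *)
Fixpoint eval (c : code) (x z : nat) {struct c} : Prop :=
  match c with
  | Zero => z = 0
  | Succ => z = S x
  | Left => z = fst (of_nat x)
  | Right => z = snd (of_nat x)
  | Pair f g => exists u v, eval f x u /\ eval g x v /\ z = to_nat (u, v)
  | Comp f g => exists y, eval g x y /\ eval f y z
  | Prec f g =>
      let a := fst (of_nat x) in
      (fix rec (n w : nat) {struct n} : Prop :=
         match n with
         | 0 => eval f a w
         | S n' => exists y, rec n' y /\ eval g (to_nat (a, to_nat (n', y))) w
         end) (snd (of_nat x)) z
  | Mu f =>
      eval f (to_nat (x, z)) 0 /\
      forall k, k < z -> exists y, eval f (to_nat (x, k)) (S y)
  end.

Fixpoint encode (c : code) : nat :=
  match c with
  | Zero => to_nat (0, 0)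
  | Succ => to_nat (1, 0)
  | Left => to_nat (2, 0)
  | Right => to_nat (3, 0)
  | Pair f g => to_nat (4, to_nat (encode f, encode g))
  | Comp f g => to_nat (5, to_nat (encode f, encode g))
  | Prec f g => to_nat (6, to_nat (encode f, encode g))
  | Mu f => to_nat (7, encode f)
  end.

(* Kleene application: [app m n z] says that the [m]-th partial recursive function is
   defined at [n] with value [z].  A number which is not the code of any expression
   is an index of the nowhere defined function. *)
Definition app (m n z : nat) : Prop := exists c, encode c = m /\ eval c n z.

Lemma eval_det c x z z' : eval c x z -> eval c x z' -> z = z'.
Proof.
revert x z z'; induction c as [| | | |f IHf g IHg|f IHf g IHg|f IHf g IHg|f IHf];
  simpl; intros x z z' H H'; try congruence.
- destruct H as (u & v & Hu & Hv & ->), H' as (u' & v' & Hu' & Hv' & ->).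
  rewrite (IHf _ _ _ Hu Hu'), (IHg _ _ _ Hv Hv'); reflexivity.
- destruct H as (y & Hy & Hz), H' as (y' & Hy' & Hz').
  rewrite (IHg _ _ _ Hy' Hy) in Hz'; eauto.
- revert z z' H H'; induction (snd (of_nat x)) as [|n IHn]; intros z z' H H'.
  + eauto.
  + destruct H as (y & Hy & Hz), H' as (y' & Hy' & Hz').
    rewrite (IHn _ _ Hy' Hy) in Hz'; eauto.
- destruct H as (H0 & Hlt), H' as (H0' & Hlt').
  destruct (Nat.lt_trichotomy z z') as [L|[E|L]]; [|exact E|].
  + destruct (Hlt' _ L) as (y & Hy); discriminate (IHf _ _ _ H0 Hy).
  + destruct (Hlt _ L) as (y & Hy); discriminate (IHf _ _ _ H0' Hy).
Qed.

Lemma encode_inj c d : encode c = encode d -> c = d.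
Proof.
revert d; induction c; intros d E; destruct d; cbn [encode] in E;
  apply to_nat_inj, pair_equal_spec in E; destruct E as [Et E];
  try discriminate Et; try reflexivity;
  try (apply to_nat_inj, pair_equal_spec in E; destruct E); f_equal; auto.
Qed.

Lemma app_det m n z z' : app m n z -> app m n z' -> z = z'.
Proof.
intros (c & Ec & Hc) (d & Ed & Hd).
assert (c = d) as <- by (apply encode_inj; congruence).
exact (eval_det _ _ _ _ Hc Hd).
Qed.

Definition is_glb {A : Type} (le : relation A) (X : A -> Prop) (m : A) : Prop :=
  (forall x, X x -> le m x) /\ (forall l, (forall x, X x -> le l x) -> le l m).

Record arrow_structure : Type := ArrowStructure {
  carrier :> Type;
  ale : relation carrier;
  inf : (carrier -> Prop) -> carrier;
  arr : carrier -> carrier -> carrier;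
  ale_order : order carrier ale;
  inf_glb : forall X, is_glb ale X (inf X);
  arr_mono : forall a a' b b', ale a' a -> ale b b' -> ale (arr a b) (arr a' b')
}.

Arguments ale {_} _ _.
Arguments inf {_} _.
Arguments arr {_} _ _.

Declare Scope arrow_scope.
Delimit Scope arrow_scope with arrow.
Local Open Scope arrow_scope.

Infix "=<" := ale (at level 70, no associativity) : arrow_scope.
Infix "~>" := arr (at level 60, right associativity) : arrow_scope.

Section Operations.
Context {A : arrow_structure}.

Definition inf_fam {I : Type} (f : I -> A) : A := inf (fun x => exists i, x = f i).
Definition bot : A := inf (fun _ => True).
Definition top : A := inf (fun _ => False).
Definition meet (a b : A) : A := inf (fun x => x = a \/ x = b).

Definition join (a b : A) : A := inf_fam (fun c => (a ~> c) ~> (b ~> c) ~> c).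

Definition comb_k : A := inf (fun x => exists a b, x = a ~> b ~> a).

Definition comb_s : A :=
  inf (fun x => exists a b c, x = (a ~> b ~> c) ~> (a ~> b) ~> a ~> c).

Definition comb_a : A :=
  inf (fun x => exists (a : A) (B : A -> Prop),
         (forall b, B b -> exists c d, b = c ~> d) /\
         x = inf (fun y => exists b, B b /\ y = a ~> b) ~> a ~> inf B).

End Operations.

Definition is_separator (A : arrow_structure) (S : A -> Prop) : Prop :=
  (forall a b, a =< b -> S a -> S b) /\
  (forall a b, S (a ~> b) -> S a -> S b) /\
  S comb_k /\ S comb_s /\ S comb_a.

(* An arrow structure with a distinguished subset; it is an arrow algebra when the
   subset is a separator. *)
Record arrow_data : Type := ArrowData {
  astr :> arrow_structure;
  sep : astr -> Prop
}.

Definition is_arrow_algebra (A : arrow_data) : Prop := is_separator A (sep A).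

Definition is_binary_implicative (A : arrow_structure) : Prop :=
  forall a b b' : A, a ~> meet b b' = meet (a ~> b) (a ~> b').

Definition is_nucleus (A : arrow_data) (j : A -> A) : Prop :=
  (forall a b, a =< b -> j a =< j b) /\
  sep A (inf (fun x => exists a, x = a ~> j a)) /\
  sep A (inf (fun x => exists a b, x = (a ~> j b) ~> j a ~> j b)).

Section OrderFacts.
Context {A : arrow_structure}.

Lemma ale_refl (a : A) : a =< a.
Proof. apply (ord_refl _ _ (ale_order A)). Qed.

Lemma ale_trans (a b c : A) : a =< b -> b =< c -> a =< c.
Proof. apply (ord_trans _ _ (ale_order A)). Qed.

Lemma inf_lb (X : A -> Prop) x : X x -> inf X =< x.
Proof. apply (inf_glb A X). Qed.

Lemma inf_greatest (X : A -> Prop) l : (forall x, X x -> l =< x) -> l =< inf X.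
Proof. apply (inf_glb A X). Qed.

Lemma inf_mono (X Y : A -> Prop) :
  (forall y, Y y -> exists x, X x /\ x =< y) -> inf X =< inf Y.
Proof.
intros H; apply inf_greatest; intros y Hy; destruct (H y Hy) as (x & Hx & Hxy).
apply ale_trans with x; [apply inf_lb|]; assumption.
Qed.

Lemma meet_mono (a a' b b' : A) : a =< a' -> b =< b' -> meet a b =< meet a' b'.
Proof.
intros Ha Hb; apply inf_mono; intros y [->| ->]; [exists a|exists b]; auto.
Qed.

Lemma meet_lb2 (a b : A) : meet a b =< b.
Proof. apply inf_lb; auto. Qed.

Lemma join_mono (a a' b : A) : a =< a' -> join a b =< join a' b.
Proof.
intros Ha; apply inf_mono; intros y [c ->].
exists ((a ~> c) ~> (b ~> c) ~> c); split; [eexists; reflexivity|].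
apply arr_mono; [|apply ale_refl].
apply arr_mono; [exact Ha|apply ale_refl].
Qed.

Lemma bot_le_top : (bot : A) =< top.
Proof. apply inf_greatest; intros x []. Qed.

End OrderFacts.

Section ArrowCat.
Context (A : arrow_data).

Definition pairs : Type := {x : A * A | fst x =< snd x}.

Definition pairs_le (x y : pairs) : Prop :=
  fst (proj1_sig x) =< fst (proj1_sig y) /\ snd (proj1_sig x) =< snd (proj1_sig y).

Definition proj_set (p : A * A -> A) (X : pairs -> Prop) : A -> Prop :=
  fun a => exists x, X x /\ a = p (proj1_sig x).

Lemma pairs_inf_proof (X : pairs -> Prop) : inf (proj_set fst X) =< inf (proj_set snd X).
Proof.
apply inf_mono; intros y (x & Hx & ->).
exists (fst (proj1_sig x)); split; [exists x; auto|exact (proj2_sig x)].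
Qed.

Definition pairs_inf (X : pairs -> Prop) : pairs :=
  exist (fun x : A * A => fst x =< snd x)
    (inf (proj_set fst X), inf (proj_set snd X)) (pairs_inf_proof X).

Definition pairs_arr (x y : pairs) : pairs :=
  let x0 := fst (proj1_sig x) in let x1 := snd (proj1_sig x) in
  let y0 := fst (proj1_sig y) in let y1 := snd (proj1_sig y) in
  exist (fun z : A * A => fst z =< snd z)
    (meet (x0 ~> y0) (x1 ~> y1), x1 ~> y1) (meet_lb2 _ _).

Lemma pairs_order : order pairs pairs_le.
Proof.
split.
- intros x; split; apply ale_refl.
- intros x y z [] []; split; eapply ale_trans; eauto.
- intros [[x0 x1] Hx] [[y0 y1] Hy] [H0 H1] [H0' H1']; simpl in *.
  assert (x0 = y0) as -> by (apply (ord_antisym _ _ (ale_order A)); auto).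
  assert (x1 = y1) as -> by (apply (ord_antisym _ _ (ale_order A)); auto).
  rewrite (proof_irrelevance _ Hx Hy); reflexivity.
Qed.

Lemma pairs_inf_glb X : is_glb pairs_le X (pairs_inf X).
Proof.
split.
- intros x Hx; split; apply inf_lb; exists x; auto.
- intros l Hl; split; apply inf_greatest; intros a (x & Hx & ->); apply (Hl x Hx).
Qed.

Lemma pairs_arr_mono a a' b b' :
  pairs_le a' a -> pairs_le b b' -> pairs_le (pairs_arr a b) (pairs_arr a' b').
Proof.
intros [] []; split; simpl; [apply meet_mono|]; apply arr_mono; auto.
Qed.

Definition arrow_structure_cat : arrow_structure :=
  ArrowStructure pairs pairs_le pairs_inf pairs_arr
    pairs_order pairs_inf_glb pairs_arr_mono.

Definition arrow_cat : arrow_data :=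
  ArrowData arrow_structure_cat (fun x : pairs => sep A (fst (proj1_sig x))).

Definition bot_top : arrow_cat :=
  exist (fun x : A * A => fst x =< snd x) (bot, top) bot_le_top.

Definition mod_nucleus (x : arrow_cat) : arrow_cat := join x bot_top.

Lemma mod_nucleus_mono (x y : arrow_cat) : x =< y -> mod_nucleus x =< mod_nucleus y.
Proof. apply join_mono. Qed.

End ArrowCat.

Section Nucleus.
Context (A : arrow_data) (j : A -> A).
Context (j_mono : forall a b, a =< b -> j a =< j b).

Definition nucleus_structure : arrow_structure.
Proof.
refine (ArrowStructure A ale inf (fun a b => a ~> j b) (ale_order A) (inf_glb A) _).
abstract (intros; apply arr_mono; auto).
Defined.

Definition nucleus_algebra : arrow_data :=
  ArrowData nucleus_structure (fun a : A => sep A (j a)).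

End Nucleus.

Definition modification (A : arrow_data) : arrow_data :=
  nucleus_algebra (arrow_cat A) (mod_nucleus A) (mod_nucleus_mono A).

Definition is_per (R : relation nat) : Prop := symmetric nat R /\ transitive nat R.

Definition per : Type := {R : relation nat | is_per R}.

Definition per_rel (R : per) : nat -> nat -> Prop := proj1_sig R.
Coercion per_rel : per >-> Funclass.

Definition per_le (R S : per) : Prop := inclusion nat R S.

Lemma per_inf_proof (X : per -> Prop) : is_per (fun x y => forall R : per, X R -> R x y).
Proof.
split.
- intros x y H R HR; apply (proj1 (proj2_sig R)); apply H; exact HR.
- intros x y z H H' R HR; apply (proj2 (proj2_sig R)) with y; [apply H|apply H']; exact HR.
Qed.

Definition per_inf (X : per -> Prop) : per := exist is_per _ (per_inf_proof X).

Lemma per_arr_proof (R S : per) :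
  is_per (fun x x' => forall y y', R y y' ->
            exists z z', app x y z /\ app x' y' z' /\ S z z').
Proof.
destruct R as [R [Rs Rt]], S as [S [Ss St]]; simpl; split.
- intros x x' H y y' Hy.
  destruct (H y' y (Rs _ _ Hy)) as (z & z' & Hz & Hz' & HS).
  exists z', z; auto.
- intros x x' x'' H H' y y' Hy.
  assert (Hyy : R y y) by (apply Rt with y'; auto).
  destruct (H y y Hyy) as (z & w & Hz & Hw & HS).
  destruct (H' y y' Hy) as (w' & z'' & Hw' & Hz'' & HS').
  rewrite (app_det _ _ _ _ Hw' Hw) in HS'.
  exists z, z''; repeat split; auto; apply St with w; auto.
Qed.

Definition per_arr (R S : per) : per := exist is_per _ (per_arr_proof R S).

Lemma per_order : order per per_le.
Proof.
split.
- intros R x y H; exact H.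
- intros R S U H H' x y HR; auto.
- intros [R HR] [S HS] H H'.
  assert (R = S) as ->.
  { apply functional_extensionality; intros x; apply functional_extensionality; intros y.
    apply propositional_extensionality; split; [apply H|apply H']. }
  rewrite (proof_irrelevance _ HR HS); reflexivity.
Qed.

Lemma per_inf_glb X : is_glb per_le X (per_inf X).
Proof.
split.
- intros R HR x y H; apply H; exact HR.
- intros L HL x y H R HR; apply (HL R HR); exact H.
Qed.

Lemma per_arr_mono R R' S S' :
  per_le R' R -> per_le S S' -> per_le (per_arr R S) (per_arr R' S').
Proof.
intros HR HS x x' H y y' Hy.
destruct (H y y' (HR _ _ Hy)) as (z & z' & Hz & Hz' & HSz).
exists z, z'; auto.
Qed.

Definition PER_K1 : arrow_data :=
  ArrowData
    (ArrowStructure per per_le per_inf per_arr per_order per_inf_glb per_arr_mono)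
    (fun R : per => exists x y, R x y).

Record indexed_data : Type := IndexedData {
  fib :> Type -> Type;
  ile : forall {I : Type}, relation (fib I);
  reindex : forall {I J : Type}, (I -> J) -> fib J -> fib I
}.

Arguments ile {_ _} _ _.
Arguments reindex _ {_ _} _ _.

Section Preorders.
Context {X : Type} (le : relation X).

Definition iso (x y : X) : Prop := le x y /\ le y x.

Definition is_top (t : X) : Prop := forall x, le x t.
Definition is_bot (b : X) : Prop := forall x, le b x.
Definition is_meet (x y m : X) : Prop := forall z, le z m <-> le z x /\ le z y.
Definition is_join (x y s : X) : Prop := forall z, le s z <-> le x z /\ le y z.
Definition is_imp (x y e : X) : Prop :=
  forall z m, is_meet z x m -> (le z e <-> le m y).

(* The poset reflection is a Heyting algebra: its structure is determined by the
   universal properties, which can be stated in the preorder itself. *)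
Definition is_preheyting : Prop :=
  preorder X le /\
  (exists t, is_top t) /\ (exists b, is_bot b) /\
  (forall x y, exists m, is_meet x y m) /\
  (forall x y, exists s, is_join x y s) /\
  (forall x y, exists e, is_imp x y e).

End Preorders.

Definition monotone {X Y : Type} (leX : relation X) (leY : relation Y) (f : X -> Y) : Prop :=
  forall x x', leX x x' -> leY (f x) (f x').

Definition is_preheyting_map {X Y : Type} (leX : relation X) (leY : relation Y)
    (f : X -> Y) : Prop :=
  monotone leX leY f /\
  (forall t, is_top leX t -> is_top leY (f t)) /\
  (forall b, is_bot leX b -> is_bot leY (f b)) /\
  (forall x y m, is_meet leX x y m -> is_meet leY (f x) (f y) (f m)) /\
  (forall x y s, is_join leX x y s -> is_join leY (f x) (f y) (f s)) /\
  (forall x y e, is_imp leX x y e -> is_imp leY (f x) (f y) (f e)).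

(* Preservation of identities and composition is required up to isomorphism only
   (pseudofunctoriality); coherence is automatic in preorders. *)
Definition is_indexed_preorder (P : indexed_data) : Prop :=
  (forall I, preorder (P I) ile) /\
  (forall I J (f : I -> J), monotone ile ile (reindex P f)) /\
  (forall I (x : P I), iso ile (reindex P (fun i => i) x) x) /\
  (forall I J K (f : I -> J) (g : J -> K) (x : P K),
     iso ile (reindex P (fun i => g (f i)) x) (reindex P f (reindex P g x))).

Definition is_pseudonatural (P Q : indexed_data) (F : forall I, P I -> Q I) : Prop :=
  (forall I, monotone ile ile (F I)) /\
  (forall I J (f : I -> J) (x : P J),
     iso ile (F I (reindex P f x)) (reindex Q f (F J x))).

Definition indexed_equivalent (P Q : indexed_data) : Prop :=
  exists (F : forall I, P I -> Q I) (G : forall I, Q I -> P I),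
    is_pseudonatural P Q F /\ is_pseudonatural Q P G /\
    (forall I (x : P I), iso ile (G I (F I x)) x) /\
    (forall I (y : Q I), iso ile (F I (G I y)) y).

Definition is_pullback {W X Y Z : Type}
    (p : W -> X) (q : W -> Y) (f : X -> Z) (g : Y -> Z) : Prop :=
  (forall w, f (p w) = g (q w)) /\
  (forall x y, f x = g y -> exists! w, p w = x /\ q w = y).

(* Monotonicity of the adjoints follows from the adjunction. *)
Definition is_left_adjoint (P : indexed_data) {I J : Type} (f : I -> J)
    (L : P I -> P J) : Prop :=
  forall x y, ile (L x) y <-> ile x (reindex P f y).

Definition is_right_adjoint (P : indexed_data) {I J : Type} (f : I -> J)
    (R : P I -> P J) : Prop :=
  forall x y, ile y (R x) <-> ile (reindex P f y) x.

Definition beck_chevalley (P : indexed_data)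
    (Q : forall I J, (I -> J) -> P I -> P J) : Prop :=
  forall (W X Y Z : Type) (p : W -> X) (q : W -> Y) (f : X -> Z) (g : Y -> Z),
    is_pullback p q f g ->
    forall y : P Y, iso ile (reindex P f (Q Y Z g y)) (Q W X p (reindex P q y)).

Definition is_tripos (P : indexed_data) : Prop :=
  is_indexed_preorder P /\
  (forall I, is_preheyting (ile : relation (P I))) /\
  (forall I J (f : I -> J), is_preheyting_map ile ile (reindex P f)) /\
  (exists ex : forall I J, (I -> J) -> P I -> P J,
     (forall I J (f : I -> J), is_left_adjoint P f (ex I J f)) /\
     beck_chevalley P ex) /\
  (exists all : forall I J, (I -> J) -> P I -> P J,
     (forall I J (f : I -> J), is_right_adjoint P f (all I J f)) /\
     beck_chevalley P all) /\
  (exists (Sigma : Type) (sigma : P Sigma),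
     forall I (phi : P I), exists chi : I -> Sigma, iso ile phi (reindex P chi sigma)).

Definition induced_tripos (A : arrow_data) : indexed_data :=
  IndexedData (fun I => I -> A)
    (fun I phi psi => sep A (inf_fam (fun i => phi i ~> psi i)))
    (fun I J f phi i => phi (f i)).

Definition Sigma_T : Type :=
  {p : per * per | per_le (fst p) (snd p) /\ snd p 0 0}.

Definition T : indexed_data :=
  IndexedData (fun I => I -> Sigma_T)
    (fun I alpha beta => exists r, forall i,
       let a := proj1_sig (alpha i) in let b := proj1_sig (beta i) in
       per_arr (fst a) (fst b) r r /\ per_arr (snd a) (snd b) r r)
    (fun I J f alpha i => alpha (f i)).

(* Main.v *)
From Stdlib Require Import Relation_Definitions Arith Cantor Lia List.
From Stdlib Require Import ProofIrrelevance.
Require Import Defs.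
Import ListNotations.
Local Open Scope arrow_scope.

(** The proof rests on reading Kleene application as a typed programming language.

    An element of the arrow algebra of pairs [x0 =< x1] of partial equivalence
    relations is treated as a type with two levels: level [false] is [x0] and level
    [true] is [x1].  The implication of pairs is then the implication of a Kripke model
    on the two-element order: an index belongs to [x ~> y] at a level when it maps [x]
    to [y] at all levels above.  A code [c] tracks a map from [x] to [y] when it does so
    at both levels.  With a universal code ([eval_U]) and a code for closures
    ([eval_Lam]), tracking obeys the typing rules of simply typed lambda calculus with
    products, sums, intersections and unions ([tracks_app], [tracks_lam_inf],
    [tracks_pair], [tracks_case], [tracks_sup]).  Everything that has to be realised
    below is a program, and the check that it realises what it should is a type
    derivation.

    Both orders to be compared are tracking relations: [a <= b] in [T I] says that one
    code tracks [a i] to [b i] for all [i] ([T_le]), and [a <= b] in the tripos of the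
    modification says that one code tracks [a i] to [j (b i)] for all [i] ([M_le]).  The
    nucleus [j] behaves as a monad with return [Ret] and bind [Bind]; this gives the
    combinators of the modification.  Its separator is that of the pairs ([sep_nucleus]),
    since a program for [j x] at level [false] can never take the summand [(bot, top)],
    empty at that level.

    The objects of [T] are the pointed pairs, those with [0] at level [true].  The join
    defining [j x] is realised by a coded disjoint sum: [j x] and [sum bot_top x] track
    each other uniformly in [x] ([tracks_to_sum], [tracks_of_sum]), and the sum is pointed
    because [bot_top] is.  On a pointed [x] the extra summand can be sent to the point
    ([tracks_bot_top]), so that [sum bot_top x] is isomorphic to [x].  Hence the inclusion
    of [T] and [a |-> sum bot_top a] are mutually inverse.

    The tripos structure of [T] is given by the type formers, all of which preserve
    pointedness because [0] codes the pair [(0, 0)] and is the index of the constant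
    function [0].  It is carried to the modification along the equivalence. *)

(** * Certified total recursive functions *)

Definition pr (a b : nat) : nat := to_nat (a, b).
Definition lft (n : nat) : nat := fst (of_nat n).
Definition rgt (n : nat) : nat := snd (of_nat n).

Lemma lft_pr a b : lft (pr a b) = a.
Proof. unfold lft, pr; rewrite cancel_of_to; reflexivity. Qed.

Lemma rgt_pr a b : rgt (pr a b) = b.
Proof. unfold rgt, pr; rewrite cancel_of_to; reflexivity. Qed.

Lemma pr_lft_rgt n : pr (lft n) (rgt n) = n.
Proof.
unfold pr, lft, rgt; rewrite <- surjective_pairing; apply cancel_to_of.
Qed.

Lemma lft_0 : lft 0 = 0.
Proof. reflexivity. Qed.

Lemma rgt_0 : rgt 0 = 0.
Proof. reflexivity. Qed.

Lemma encode_Zero : encode Zero = 0.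
Proof. reflexivity. Qed.

(* Numbers are unary: a code or a pair of numerals must never be computed. *)
Opaque to_nat of_nat.

Lemma eval_Pair f g x u v : eval f x u -> eval g x v -> eval (Pair f g) x (pr u v).
Proof. intros Hu Hv; exists u, v; auto. Qed.

Lemma eval_Comp f g x y z : eval g x y -> eval f y z -> eval (Comp f g) x z.
Proof. intros Hy Hz; exists y; auto. Qed.

Lemma app_encode c x z : eval c x z -> app (encode c) x z.
Proof. intros H; exists c; auto. Qed.

(** A total function with a code for it, so that programs can be composed and computed as
    functions while their codes are assembled alongside. *)
Record computable : Type := Computable {
  run :> nat -> nat;
  src : code;
  src_run : forall x, eval src x (run x)
}.

Definition zero_c : computable := Computable (fun _ => 0) Zero (fun _ => eq_refl).
Definition succ_c : computable := Computable S Succ (fun _ => eq_refl).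
Definition left_c : computable := Computable lft Left (fun _ => eq_refl).
Definition right_c : computable := Computable rgt Right (fun _ => eq_refl).

Definition pair_c (f g : computable) : computable :=
  Computable (fun x => pr (f x) (g x)) (Pair (src f) (src g))
    (fun x => eval_Pair _ _ _ _ _ (src_run f x) (src_run g x)).

Definition comp_c (f g : computable) : computable :=
  Computable (fun x => f (g x)) (Comp (src f) (src g))
    (fun x => eval_Comp _ _ _ _ _ (src_run g x) (src_run f (g x))).

Definition Id : code := Pair Left Right.

Lemma eval_Id x : eval Id x x.
Proof.
rewrite <- (pr_lft_rgt x) at 2; apply eval_Pair; reflexivity.
Qed.

Definition id_c : computable := Computable (fun x => x) Id eval_Id.

Fixpoint Const (n : nat) : code :=
  match n with 0 => Zero | S n => Comp Succ (Const n) end.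

Lemma eval_Const n x : eval (Const n) x n.
Proof.
induction n as [|n IH]; [reflexivity|]; exact (eval_Comp Succ _ _ _ _ IH eq_refl).
Qed.

Definition const_c (n : nat) : computable := Computable (fun _ => n) (Const n) (eval_Const n).

Lemma eval_Prec (f g : computable) x :
  eval (Prec (src f) (src g)) x
    (nat_rect (fun _ => nat) (f (lft x)) (fun n y => g (pr (lft x) (pr n y))) (rgt x)).
Proof.
simpl; fold (lft x) (rgt x); induction (rgt x) as [|n IH]; simpl.
- apply src_run.
- eexists; split; [exact IH|apply src_run].
Qed.

Definition rec_c (f g : computable) : computable := Computable _ _ (eval_Prec f g).

Declare Scope comp_scope.
Delimit Scope comp_scope with comp.
Bind Scope comp_scope with computable.
Local Infix "∘" := comp_c (at level 40, left associativity) : comp_scope.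
Local Notation "⟨ f , g ⟩" := (pair_c f g) : comp_scope.
Local Open Scope comp_scope.

(** Recursion that forgets the value at the predecessor. *)
Definition case_c (f g : computable) : computable :=
  rec_c f (g ∘ ⟨left_c, left_c ∘ right_c⟩).

Lemma run_case (f g : computable) x t :
  case_c f g (pr x t) = match t with 0 => f x | S t' => g (pr x t') end.
Proof.
unfold case_c; cbn [run rec_c]; rewrite lft_pr, rgt_pr; destruct t; [reflexivity|].
cbn [nat_rect run comp_c pair_c left_c right_c]; rewrite rgt_pr, !lft_pr; reflexivity.
Qed.

Fixpoint switch (fs : list computable) : computable :=
  match fs with
  | [] => left_c
  | f :: fs => case_c f (switch fs)
  end.

Lemma run_switch fs x t : switch fs (pr x t) = nth t fs id_c x.
Proof.
revert t; induction fs as [|f fs IH]; intros t; cbn [switch].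
- cbn [run left_c]; rewrite lft_pr; destruct t; reflexivity.
- rewrite run_case; destruct t; [reflexivity|apply IH].
Qed.

Definition iter_c (f : computable) : computable := rec_c id_c (f ∘ right_c ∘ right_c).

Lemma run_iter f x n : iter_c f (pr x n) = Nat.iter n f x.
Proof.
unfold iter_c; cbn [run rec_c]; rewrite lft_pr, rgt_pr.
induction n as [|n IH]; [reflexivity|].
change (Nat.iter (S n) f x) with (f (Nat.iter n f x)); rewrite <- IH.
cbn [nat_rect]; cbn [run comp_c right_c]; rewrite !rgt_pr; reflexivity.
Qed.

(** Minimisation of a total function stops as soon as some zero exists. *)
Lemma eval_Mu (f : computable) x n :
  f (pr x n) = 0 -> exists m, m <= n /\ f (pr x m) = 0 /\ eval (Mu (src f)) x m.
Proof.
assert (H : forall n, (forall k, k < n -> f (pr x k) <> 0) \/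
          exists m, m < n /\ f (pr x m) = 0 /\ forall k, k < m -> f (pr x k) <> 0).
{ clear n; intros n; induction n as [|n [IH|(m & Hm & H)]].
  - left; intros k Hk; lia.
  - destruct (Nat.eq_dec (f (pr x n)) 0) as [E|E].
    + right; exists n; auto.
    + left; intros k Hk; destruct (Nat.eq_dec k n) as [->|]; [exact E|apply IH; lia].
  - right; exists m; split; [lia|exact H]. }
intros Hn; destruct (H (S n)) as [L|(m & Hm & H0 & Hlt)]; [destruct (L n); auto|].
exists m; split; [lia|]; split; [exact H0|]; split.
- rewrite <- H0; apply src_run.
- intros k Hk; exists (pred (f (pr x k))).
  rewrite Nat.succ_pred by auto; apply src_run.
Qed.

(** * A universal code *)

(** The interpreter is a stack machine.  A state [pr v k] holds a value [v] and a stack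
    [k] of instructions still to be applied to it; an instruction is either the number of
    a code, which starts with a tag from 0 to 7, or one of four frames (tags 8 to 11) that
    keep the data needed to resume a computation.  The empty stack is [0] and a push is a
    successor, so that halting is the vanishing of the stack. *)
Definition push (i k : nat) : nat := S (pr i k).
Definition push_c (i k : computable) : computable :=
  Computable (fun x => push (i x) (k x)) _ (src_run (succ_c ∘ ⟨i, k⟩)).

Definition value_c : computable := left_c.
Definition instr_c : computable := left_c ∘ right_c.
Definition arg_c : computable := right_c ∘ instr_c.
Definition stack_c : computable := right_c ∘ right_c.
Definition fst_c : computable := left_c ∘ arg_c.
Definition snd_c : computable := right_c ∘ arg_c.

Definition frame (tag : nat) (a : computable) : computable := ⟨const_c tag, a⟩.

(** Each entry acts on [pr v (pr (pr tag arg) k)], where [pr tag arg] is the instruction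
    just popped from the stack. *)
Definition instructions : list computable := [
  (* Zero, Succ, Left, Right *)
  ⟨zero_c, stack_c⟩;
  ⟨succ_c ∘ value_c, stack_c⟩;
  ⟨left_c ∘ value_c, stack_c⟩;
  ⟨right_c ∘ value_c, stack_c⟩;
  (* Pair f g *)
  ⟨value_c, push_c fst_c (push_c (frame 8 ⟨value_c, snd_c⟩) stack_c)⟩;
  (* Comp f g *)
  ⟨value_c, push_c snd_c (push_c fst_c stack_c)⟩;
  (* Prec f g *)
  case_c
    ⟨left_c ∘ value_c, push_c fst_c stack_c⟩
    ⟨⟨left_c ∘ value_c ∘ left_c, right_c⟩,
     push_c (instr_c ∘ left_c)
       (push_c (frame 9 ⟨left_c ∘ value_c ∘ left_c, ⟨right_c, snd_c ∘ left_c⟩⟩)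
          (stack_c ∘ left_c))⟩
  ∘ ⟨id_c, right_c ∘ value_c⟩;
  (* Mu f *)
  ⟨⟨value_c, zero_c⟩,
   push_c arg_c (push_c (frame 10 ⟨arg_c, ⟨value_c, zero_c⟩⟩) stack_c)⟩;
  (* Frame 8, argument <x, g>: the first component is computed, resume with g on x. *)
  ⟨fst_c, push_c snd_c (push_c (frame 11 value_c) stack_c)⟩;
  (* Frame 9, argument <a, <n, g>>: the value at n is computed, resume with g. *)
  ⟨⟨fst_c, ⟨left_c ∘ snd_c, value_c⟩⟩, push_c (right_c ∘ snd_c) stack_c⟩;
  (* Frame 10, argument <f, <x, k>>: f <x, k> is computed, stop or try k + 1. *)
  case_c
    ⟨right_c ∘ snd_c, stack_c⟩
    (⟨⟨left_c ∘ snd_c, succ_c ∘ right_c ∘ snd_c⟩,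
      push_c fst_c
        (push_c (frame 10 ⟨fst_c, ⟨left_c ∘ snd_c, succ_c ∘ right_c ∘ snd_c⟩⟩) stack_c)⟩
     ∘ left_c)
  ∘ ⟨id_c, value_c⟩;
  (* Frame 11, argument u: both components are computed, pair them. *)
  ⟨⟨arg_c, value_c⟩, stack_c⟩ ].

Definition step_c : computable :=
  case_c ⟨id_c, zero_c⟩ (switch instructions ∘ ⟨id_c, left_c ∘ instr_c⟩).

Ltac run_simpl :=
  unfold frame, fst_c, snd_c, arg_c, instr_c, value_c, stack_c;
  cbn [run comp_c pair_c push_c left_c right_c succ_c zero_c const_c id_c];
  rewrite ?run_case, ?lft_pr, ?rgt_pr;
  repeat progress (cbn [run comp_c pair_c push_c left_c right_c succ_c zero_c const_c id_c];
  rewrite ?lft_pr, ?rgt_pr).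

Lemma step_halt v : step_c (pr v 0) = pr v 0.
Proof. unfold step_c; rewrite run_case; reflexivity. Qed.

Lemma step_instr tag arg v k :
  step_c (pr v (push (pr tag arg) k)) =
  nth tag instructions id_c (pr v (pr (pr tag arg) k)).
Proof.
unfold step_c, push; rewrite run_case; cbn [run comp_c pair_c id_c].
rewrite run_switch; f_equal; f_equal.
run_simpl; reflexivity.
Qed.

Definition reaches (s t : nat) : Prop := exists n, Nat.iter n step_c s = t.

Lemma reaches_refl s : reaches s s.
Proof. exists 0; reflexivity. Qed.

Lemma reaches_trans s t u : reaches s t -> reaches t u -> reaches s u.
Proof.
intros (n & <-) (m & <-); exists (m + n); apply Nat.iter_add.
Qed.

Lemma reaches_step s t u : step_c s = t -> reaches t u -> reaches s u.
Proof. intros <-; apply reaches_trans; exists 1; reflexivity. Qed.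

Ltac machine_step :=
  eapply reaches_step;
  [rewrite step_instr; cbn [nth instructions]; run_simpl; reflexivity|].

(** Running the code of [c] on top of any stack replaces the argument by the value and
    leaves the stack below untouched; this is what makes the induction on [c] compose. *)
Lemma machine_eval c x z :
  eval c x z -> forall k, reaches (pr x (push (encode c) k)) (pr z k).
Proof.
revert x z; induction c as [| | | |f IHf g IHg|f IHf g IHg|f IHf g IHg|f IHf];
  intros x z H k; cbn [encode];
  repeat match goal with |- context[to_nat (?a, ?b)] => change (to_nat (a, b)) with (pr a b) end.
- simpl in H; subst; machine_step; apply reaches_refl.
- simpl in H; subst; machine_step; apply reaches_refl.
- simpl in H; subst; machine_step; apply reaches_refl.
- simpl in H; subst; machine_step; apply reaches_refl.
- destruct H as (u & v & Hu & Hv & ->).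
  machine_step; eapply reaches_trans; [apply (IHf _ _ Hu)|].
  machine_step; eapply reaches_trans; [apply (IHg _ _ Hv)|].
  machine_step; apply reaches_refl.
- destruct H as (y & Hy & Hz).
  machine_step; eapply reaches_trans; [apply (IHg _ _ Hy)|apply (IHf _ _ Hz)].
- cbn [eval] in H; fold (lft x) in H; fold (rgt x) in H.
  rewrite <- (pr_lft_rgt x).
  revert z k H; induction (rgt x) as [|n IHn]; intros z k H.
  + machine_step; exact (IHf _ _ H k).
  + destruct H as (y & Hy & Hz).
    machine_step; eapply reaches_trans; [apply (IHn _ _ Hy)|].
    machine_step; exact (IHg _ _ Hz k).
- destruct H as (H0 & Hlt).
  machine_step.
  (* The search resumed at any candidate [m] up to the least zero [z] ends in [z]. *)
  assert (Hm : forall m, m <= z ->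
    reaches (pr (pr x m) (push (encode f) (push (pr 10 (pr (encode f) (pr x m))) k))) (pr z k)).
  { intros m Hm; remember (z - m) as d eqn:E; revert m Hm E.
    induction d as [|d IHd]; intros m Hm E.
    - assert (m = z) as -> by lia.
      eapply reaches_trans; [apply (IHf _ _ H0)|]; machine_step; apply reaches_refl.
    - destruct (Hlt m ltac:(lia)) as (y & Hy).
      eapply reaches_trans; [apply (IHf _ _ Hy)|]; machine_step; apply IHd; lia. }
  apply (Hm 0); lia.
Qed.

Definition init_c : computable := ⟨right_c, push_c left_c zero_c⟩.

(** Searches for a halting time of the machine and reads off the value. *)
Definition U : code :=
  Comp (src (left_c ∘ iter_c step_c))
    (Pair (src init_c)
       (Mu (src (right_c ∘ iter_c step_c ∘ ⟨init_c ∘ left_c, right_c⟩)))).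

Lemma iter_halt n v : Nat.iter n step_c (pr v 0) = pr v 0.
Proof.
induction n as [|n IH]; [reflexivity|].
change (step_c (Nat.iter n step_c (pr v 0)) = pr v 0); rewrite IH; apply step_halt.
Qed.

(** Nothing is claimed about [U] where [m] is undefined at [n]: realisers are only ever
    run where they are defined. *)
Lemma eval_U m n z : app m n z -> eval U (pr m n) z.
Proof.
intros (c & <- & H).
destruct (machine_eval c n z H 0) as (t & Ht).
assert (Ei : init_c (pr (encode c) n) = pr n (push (encode c) 0))
  by (unfold init_c; run_simpl; reflexivity).
pose (h := right_c ∘ iter_c step_c ∘ ⟨init_c ∘ left_c, right_c⟩).
assert (Eh : forall k, h (pr (pr (encode c) n) k) =
    rgt (Nat.iter k step_c (pr n (push (encode c) 0)))).
{ intros k; unfold h; cbn [run comp_c pair_c right_c left_c].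
  rewrite lft_pr, rgt_pr, Ei, run_iter; reflexivity. }
destruct (eval_Mu h (pr (encode c) n) t) as (t0 & Hle & H0 & Hmu);
  [rewrite Eh, Ht; apply rgt_pr|].
rewrite Eh in H0.
eapply eval_Comp; [eapply eval_Pair; [apply src_run|exact Hmu]|].
rewrite Ei.
enough (E : z = (left_c ∘ iter_c step_c) (pr (pr n (push (encode c) 0)) t0))
  by (rewrite E at 1; apply src_run).
cbn [run comp_c left_c]; rewrite run_iter.
(* A halted machine stays put, so its state at the time found is the final one. *)
revert H0 Ht; replace t with ((t - t0) + t0) by lia; rewrite Nat.iter_add.
rewrite <- (pr_lft_rgt (Nat.iter t0 _ _)); rewrite rgt_pr; intros ->.
rewrite iter_halt, lft_pr; intros E; rewrite <- (lft_pr z 0), <- E, lft_pr; reflexivity.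
Qed.

Definition App (c d : code) : code := Comp U (Pair c d).

Lemma eval_App c d x m n z : eval c x m -> eval d x n -> app m n z -> eval (App c d) x z.
Proof.
intros Hm Hn H; eapply eval_Comp; [apply eval_Pair; eassumption|apply eval_U, H].
Qed.

(** * Abstraction and case distinction *)

(** The code of [Const n] as a computable function of [n]. *)
Definition quote_c : computable :=
  rec_c (const_c (encode Zero))
    ⟨const_c 5, ⟨const_c (encode Succ), right_c ∘ right_c⟩⟩ ∘ ⟨zero_c, id_c⟩.

Lemma run_quote n : quote_c n = encode (Const n).
Proof.
unfold quote_c; cbn [run comp_c pair_c rec_c const_c right_c zero_c id_c].
rewrite rgt_pr, lft_pr.
induction n as [|n IH]; [reflexivity|].
cbn [nat_rect]; rewrite !rgt_pr; cbn [Const encode]; rewrite <- IH; reflexivity.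
Qed.

(** The index of [x |-> c <e, x>]: the parameter theorem. *)
Definition closure (c : code) (e : nat) : nat := encode (Comp c (Pair (Const e) Id)).

Lemma app_closure c e x z : eval c (pr e x) z -> app (closure c e) x z.
Proof.
intros H; apply app_encode; eapply eval_Comp; [|exact H].
apply eval_Pair; [apply eval_Const|apply eval_Id].
Qed.

Definition lam_c (c : code) : computable :=
  ⟨const_c 5, ⟨const_c (encode c), ⟨const_c 4, ⟨quote_c, const_c (encode Id)⟩⟩⟩⟩.

Definition Lam (c : code) : code := src (lam_c c).

(** [Lam c] is total, whatever [c] is; implications into empty intersections, which contain
    every number, are realised only because of this. *)
Lemma eval_Lam c e : eval (Lam c) e (closure c e).
Proof.
enough (E : closure c e = lam_c c e) by (rewrite E; apply src_run).
unfold lam_c; cbn [run pair_c const_c]; rewrite run_quote; reflexivity.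
Qed.

(** Branching by primitive recursion would run [f] even where the tag selects [g], and might
    diverge.  So only the index of the branch is selected, and then applied. *)
Definition Case (f g : code) : code :=
  App (src (case_c (const_c (encode f)) (const_c (encode g)))) Left.

Lemma eval_Case f g n z :
  match rgt n with 0 => eval f (lft n) z | S _ => eval g (lft n) z end ->
  eval (Case f g) n z.
Proof.
intros H; eapply eval_App; [apply src_run|reflexivity|].
fold (lft n); rewrite <- (pr_lft_rgt n) at 1; rewrite run_case.
destruct (rgt n); apply app_encode, H.
Qed.

(** * Pairs of partial equivalence relations as two-level types *)

Local Notation ob := (carrier (astr (arrow_cat PER_K1))).

Lemma per_sym (R : per) n n' : R n n' -> R n' n.
Proof. apply (proj1 (proj2_sig R)). Qed.

Lemma per_trans (R : per) n n' n'' : R n n' -> R n' n'' -> R n n''.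
Proof. apply (proj2 (proj2_sig R)). Qed.

Definition level (x : ob) (w : bool) : per := (if w then snd else fst) (proj1_sig x).

Lemma le_refl_bool w : Bool.le w w.
Proof. destruct w; easy. Qed.

Lemma level_mono (x : ob) w v n n' : Bool.le w v -> level x w n n' -> level x v n n'.
Proof.
destruct w, v; try discriminate; intros _; [auto|apply (proj2_sig x)|auto].
Qed.

Lemma le_level (x y : ob) :
  x =< y <-> forall w n n', level x w n n' -> level y w n n'.
Proof.
split.
- intros [H0 H1] [|]; [exact H1|exact H0].
- intros H; split; [exact (H false)|exact (H true)].
Qed.

Lemma le_antisym {A : arrow_structure} (a b : A) : a =< b -> b =< a -> a = b.
Proof. apply (ord_antisym _ _ (ale_order A)). Qed.

(** The definition of the first component of [x ~> y] as a meet is the clause of Kripke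
    semantics for the implication. *)
Lemma level_arr (x y : ob) w r r' :
  level (x ~> y) w r r' <->
  forall v, Bool.le w v -> forall n n', level x v n n' ->
    exists m m', app r n m /\ app r' n' m' /\ level y v m m'.
Proof.
split.
- destruct w; simpl.
  + intros H [|] Hv; [exact H|discriminate].
  + intros H [|] _; [exact (H _ (or_intror eq_refl))|exact (H _ (or_introl eq_refl))].
- intros H; destruct w; simpl.
  + exact (H true eq_refl).
  + intros Q [->| ->]; [exact (H false I)|exact (H true I)].
Qed.

Lemma level_inf (X : ob -> Prop) w n n' :
  level (inf X) w n n' <-> forall x, X x -> level x w n n'.
Proof.
split.
- intros H x Hx; destruct w; apply H; exists x; auto.
- intros H; destruct w; intros R (x & Hx & ->); [apply (H x Hx)|apply (H x Hx)].
Qed.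

(** * Typing rules for codes *)

Definition tracks (x : ob) (c : code) (y : ob) : Prop :=
  forall w n n', level x w n n' ->
    exists m m', eval c n m /\ eval c n' m' /\ level y w m m'.

Lemma tracks_arr (x y : ob) c w : tracks x c y -> level (x ~> y) w (encode c) (encode c).
Proof.
intros H; apply level_arr; intros v _ n n' Hn.
destruct (H v n n' Hn) as (m & m' & Hm & Hm' & Hy).
exists m, m'; auto using app_encode.
Qed.

Lemma tracks_le (x y : ob) : x =< y -> tracks x Id y.
Proof.
intros H w n n' Hn; exists n, n'; repeat split; try apply eval_Id.
apply le_level with x; assumption.
Qed.

Lemma tracks_id (x : ob) : tracks x Id x.
Proof. apply tracks_le, ale_refl. Qed.

Lemma tracks_comp (x y z : ob) c d : tracks x d y -> tracks y c z -> tracks x (Comp c d) z.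
Proof.
intros Hd Hc w n n' Hn.
destruct (Hd w n n' Hn) as (m & m' & Hm & Hm' & Hy).
destruct (Hc w m m' Hy) as (p & p' & Hp & Hp' & Hz).
exists p, p'; repeat split; [exact (eval_Comp _ _ _ _ _ Hm Hp)| |exact Hz].
exact (eval_Comp _ _ _ _ _ Hm' Hp').
Qed.

Lemma tracks_sub (x y y' : ob) c : tracks x c y -> y =< y' -> tracks x c y'.
Proof.
intros Hc Hy w n n' Hn.
destruct (Hc w n n' Hn) as (m & m' & Hm & Hm' & H).
exists m, m'; repeat split; auto; apply le_level with y; assumption.
Qed.

Definition rel_prod (R S : relation nat) : relation nat :=
  fun n n' => R (lft n) (lft n') /\ S (rgt n) (rgt n').

Lemma rel_prod_per (R S : per) : is_per (rel_prod R S).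
Proof.
split.
- intros n n' [H H']; split; apply per_sym; assumption.
- intros n m p [H H'] [K K']; split; eapply per_trans; eassumption.
Qed.

Definition ob_intro (F : bool -> per)
  (H : forall n n', F false n n' -> F true n n') : ob :=
  exist (fun x : PER_K1 * PER_K1 => fst x =< snd x) (F false, F true) H.

Definition prod (x y : ob) : ob.
Proof.
refine (ob_intro (fun w => exist _ _ (rel_prod_per (level x w) (level y w))) _).
abstract (intros n n' [H H']; split; apply (level_mono _ false true); simpl; auto).
Defined.

Lemma level_prod (x y : ob) w n n' :
  level (prod x y) w n n' <-> level x w (lft n) (lft n') /\ level y w (rgt n) (rgt n').
Proof. destruct w; reflexivity. Qed.

Lemma tracks_left (x y : ob) : tracks (prod x y) Left x.
Proof.
intros w n n' Hn; apply level_prod in Hn.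
exists (lft n), (lft n'); repeat split; apply Hn.
Qed.

Lemma tracks_right (x y : ob) : tracks (prod x y) Right y.
Proof.
intros w n n' Hn; apply level_prod in Hn.
exists (rgt n), (rgt n'); repeat split; apply Hn.
Qed.

Lemma tracks_pair (x y z : ob) c d :
  tracks x c y -> tracks x d z -> tracks x (Pair c d) (prod y z).
Proof.
intros Hc Hd w n n' Hn.
destruct (Hc w n n' Hn) as (m & m' & Hm & Hm' & Hy).
destruct (Hd w n n' Hn) as (p & p' & Hp & Hp' & Hz).
exists (pr m p), (pr m' p'); repeat split; auto using eval_Pair.
apply level_prod; rewrite !lft_pr, !rgt_pr; auto.
Qed.

(** Contexts are left-nested products, so this is weakening; [Right] is the most recent
    variable. *)
Lemma tracks_skip (x y z : ob) c : tracks x c z -> tracks (prod x y) (Comp c Left) z.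
Proof. intros H; eapply tracks_comp; [apply tracks_left|exact H]. Qed.

Lemma tracks_app (x y z : ob) c d : tracks x c (y ~> z) -> tracks x d y -> tracks x (App c d) z.
Proof.
intros Hc Hd w n n' Hn.
destruct (Hc w n n' Hn) as (r & r' & Hr & Hr' & Hyz).
destruct (Hd w n n' Hn) as (p & p' & Hp & Hp' & Hy).
destruct (proj1 (level_arr _ _ _ _ _) Hyz w (le_refl_bool w) p p' Hy)
  as (m & m' & Hm & Hm' & Hz).
exists m, m'; repeat split; eauto using eval_App.
Qed.

(** Abstraction into an intersection of implications.  The
    closure is formed before any member of [Y] is inspected, so the empty intersection is
    covered as well, as the combinator [comb_a] demands. *)
Lemma tracks_lam_inf (x : ob) (Y : ob -> Prop) c :
  (forall y, Y y -> exists u v, y = u ~> v /\ tracks (prod x u) c v) ->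
  tracks x (Lam c) (inf Y).
Proof.
intros H w n n' Hn; exists (closure c n), (closure c n').
repeat split; try apply eval_Lam.
apply level_inf; intros y Hy; destruct (H y Hy) as (u & v & -> & Hc).
apply level_arr; intros w' Hw' p p' Hp.
destruct (Hc w' (pr n p) (pr n' p')) as (m & m' & Hm & Hm' & Hv).
- apply level_prod; rewrite !lft_pr, !rgt_pr; split; [|exact Hp].
  exact (level_mono _ _ _ _ _ Hw' Hn).
- exists m, m'; auto using app_closure.
Qed.

Lemma tracks_lam (x y z : ob) c : tracks (prod x y) c z -> tracks x (Lam c) (y ~> z).
Proof.
intros H; apply tracks_sub with (inf (fun u => u = y ~> z)).
- apply tracks_lam_inf; intros u ->; eauto.
- apply inf_lb; reflexivity.
Qed.

(** Any index, even one that is the number of no code, is applied by a code: hence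
    a realiser in the sense of an order and a tracking code are the same thing. *)
Lemma tracks_index (x y : ob) r :
  level (x ~> y) false r r -> tracks x (App (Const r) Id) y.
Proof.
intros H w n n' Hn.
destruct (proj1 (level_arr _ _ _ _ _) H w I n n' Hn) as (m & m' & Hm & Hm' & Hy).
exists m, m'; repeat split; auto;
  (eapply eval_App; [apply eval_Const|apply eval_Id|assumption]).
Qed.

(** * The arrow algebra of partial equivalence relations *)

(** Constant pairs form a copy of the algebra closed under implication and infima, so that
    the typing rules for pairs also serve for single relations. *)
Definition diag (R : PER_K1) : ob := exist _ (R, R) (ale_refl R).

Lemma level_diag R w : level (diag R) w = R.
Proof. destruct w; reflexivity. Qed.

Lemma diag_arr (R S : PER_K1) : diag (R ~> S) = diag R ~> diag S.
Proof.
apply le_antisym; apply le_level; intros w n n'; rewrite level_arr, level_diag.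
- intros H v _; rewrite !level_diag; exact H.
- intros H; specialize (H w (le_refl_bool w)); rewrite !level_diag in H; exact H.
Qed.

Lemma diag_inf (X : PER_K1 -> Prop) :
  diag (inf X) = inf (fun x => exists R, X R /\ x = diag R).
Proof.
apply le_antisym; apply le_level; intros w n n'; rewrite level_inf, level_diag.
- intros H x (R & HR & ->); rewrite level_diag; apply H, HR.
- intros H R HR; rewrite <- (level_diag R w); apply H; eauto.
Qed.

Lemma diag_le (R S : PER_K1) : R =< S -> diag R =< diag S.
Proof. intros H; split; exact H. Qed.

Lemma sep_PER_inf (X : PER_K1 -> Prop) c :
  (forall R, X R -> exists x y, diag R = x ~> y /\ tracks x c y) -> sep PER_K1 (inf X).
Proof.
intros H; exists (encode c), (encode c); intros R HR.
destruct (H R HR) as (x & y & E & Hc).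
change (level (diag R) false (encode c) (encode c)).
rewrite E; apply tracks_arr, Hc.
Qed.

Lemma PER_K1_algebra : is_arrow_algebra PER_K1.
Proof.
repeat split.
- intros R S H (n & n' & HR); exists n, n'; apply H, HR.
- intros R S (r & r' & H) (n & n' & HR).
  destruct (H n n' HR) as (m & m' & _ & _ & HS); exists m, m'; exact HS.
- apply sep_PER_inf with (Lam Left); intros R (a & b & ->).
  rewrite !diag_arr; do 2 eexists; split; [reflexivity|].
  apply tracks_lam, tracks_left.
- (* The context is ((x, y), z), and the body is (x z) (y z). *)
  apply sep_PER_inf with
    (Lam (Lam (App (App (Comp Left Left) Right) (App (Comp Right Left) Right)))).
  intros R (a & b & c & ->).
  rewrite !diag_arr; do 2 eexists; split; [reflexivity|].
  apply tracks_lam, tracks_lam; repeat eapply tracks_app; try apply tracks_right.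
  + apply tracks_skip, tracks_left.
  + apply tracks_skip, tracks_right.
- (* The member [c ~> d] of [B] is eta-expanded: z is its argument, and the body is x y z. *)
  apply sep_PER_inf with (Lam (Lam (App (App (Comp Left Left) (Comp Right Left)) Right))).
  intros R (a & B & HB & ->).
  rewrite !diag_arr, (diag_inf B); do 2 eexists; split; [reflexivity|].
  apply tracks_lam, tracks_lam_inf; intros y (b & Hb & ->).
  destruct (HB b Hb) as (c & d & ->); rewrite diag_arr; do 2 eexists; split; [reflexivity|].
  eapply tracks_app; [|apply tracks_right].
  eapply tracks_app; [|apply tracks_skip, tracks_right].
  apply tracks_skip; eapply tracks_sub; [apply tracks_left|].
  rewrite <- !diag_arr; apply diag_le, inf_lb; eauto.
Qed.

(** The same value lies in both relations because application is single-valued. *)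
Lemma PER_K1_binary_implicative : is_binary_implicative PER_K1.
Proof.
intros R S S'; apply le_antisym.
- intros r r' H Q [->| ->]; intros n n' Hn;
    destruct (H n n' Hn) as (m & m' & Hm & Hm' & HS); exists m, m'; auto.
- intros r r' H n n' Hn.
  destruct (H (R ~> S) (or_introl eq_refl) n n' Hn) as (m & m' & Hm & Hm' & HS).
  destruct (H (R ~> S') (or_intror eq_refl) n n' Hn) as (p & p' & Hp & Hp' & HS').
  exists m, m'; repeat split; auto; intros Q [->| ->]; [exact HS|].
  rewrite (app_det _ _ _ _ Hm Hp), (app_det _ _ _ _ Hm' Hp'); exact HS'.
Qed.

(** * The nucleus and the modification *)

Local Notation j := (mod_nucleus PER_K1).
Local Notation bot_top := (bot_top PER_K1).

(** [j x] is the intersection over [z] of [(x ~> z) ~> (bot_top ~> z) ~> z], the type of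
    programs [p |-> q |-> ...] that end by calling [p] on an element of [x] or [q] on an
    element of [bot_top].  [Ret] calls the first. *)
Definition Ret (c : code) : code :=
  Lam (Lam (App (Comp Right Left) (Comp (Comp c Left) Left))).

(** Runs [c], continues with [d] on the element of the left summand, and passes the second
    continuation on unchanged. *)
Definition Bind (c d : code) : code :=
  Lam (Lam (App (App (Comp (Comp c Left) Left)
                     (Lam (App (App (Comp d (Pair (Comp (Comp Left Left) Left) Right))
                                    (Comp (Comp Right Left) Left))
                               (Comp Right Left))))
                Right)).

Lemma tracks_ret (x y : ob) c : tracks x c y -> tracks x (Ret c) (j y).
Proof.
intros H; apply tracks_lam_inf; intros u (z & ->).
do 2 eexists; split; [reflexivity|]; apply tracks_lam.
eapply tracks_app; [apply tracks_skip, tracks_right|].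
apply tracks_skip, tracks_skip, H.
Qed.

Lemma j_elim (y z : ob) : j y =< (y ~> z) ~> (bot_top ~> z) ~> z.
Proof. apply inf_lb; eauto. Qed.

Lemma tracks_bind (x y z : ob) c d :
  tracks x c (j y) -> tracks (prod x y) d (j z) -> tracks x (Bind c d) (j z).
Proof.
intros Hc Hd; apply tracks_lam_inf; intros u (t & ->).
do 2 eexists; split; [reflexivity|]; apply tracks_lam.
eapply tracks_app; [eapply tracks_app|apply tracks_right].
- eapply tracks_sub; [apply tracks_skip, tracks_skip, Hc|apply j_elim].
- apply tracks_lam; eapply tracks_app; [|apply tracks_skip, tracks_right].
  eapply tracks_app; [|apply tracks_skip, tracks_skip, tracks_right].
  eapply tracks_sub; [|apply j_elim].
  eapply tracks_comp; [|exact Hd].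
  apply tracks_pair; [apply tracks_skip, tracks_skip, tracks_left|apply tracks_right].
Qed.

Lemma sep_cat_inf (X : ob -> Prop) c :
  (forall x, X x -> exists u v, x = u ~> v /\ tracks u c v) -> sep (arrow_cat PER_K1) (inf X).
Proof.
intros H; exists (encode c), (encode c).
apply (level_inf X false); intros x Hx; destruct (H x Hx) as (u & v & -> & Hc).
apply tracks_arr, Hc.
Qed.

Lemma mod_nucleus_is_nucleus : is_nucleus (arrow_cat PER_K1) j.
Proof.
split; [apply mod_nucleus_mono|split].
- apply sep_cat_inf with (Ret Id); intros x (a & ->).
  do 2 eexists; split; [reflexivity|]; apply tracks_ret, tracks_id.
- apply sep_cat_inf with (Lam (Bind Right (App (Comp Left Left) Right))).
  intros x (a & b & ->); do 2 eexists; split; [reflexivity|].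
  apply tracks_lam; eapply tracks_bind; [apply tracks_right|].
  eapply tracks_app; [|apply tracks_right]; apply tracks_skip, tracks_left.
Qed.

Lemma level_bot_top n n' : ~ level bot_top false n n'.
Proof.
assert (H : is_per (fun _ _ => False)) by (split; intros ? **; assumption).
intros K; exact (K (exist _ _ H) I).
Qed.

Definition with_top (x : ob) : ob :=
  ob_intro (fun w => if w then (top : PER_K1) else level x false)
    (fun n n' _ R (HR : False) => match HR with end).

(** A program for [j x] at level [false], used at the type [(x_0, top)], yields an element
    of [x_0]: both [x] and [bot_top] are included in that type. *)
Lemma sep_nucleus (x : ob) : sep (arrow_cat PER_K1) (j x) <-> sep (arrow_cat PER_K1) x.
Proof.
split; intros (n & n' & H).
- change (level (j x) false n n') in H.
  apply (proj1 (le_level _ _) (j_elim x (with_top x))) in H.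
  assert (H1 : tracks x Id (with_top x)).
  { apply tracks_le, le_level; intros [|] m m' Hm; [|exact Hm]; intros R []. }
  assert (H2 : tracks bot_top Id (with_top x)).
  { apply tracks_le, le_level; intros [|] m m' Hm; [intros R []|].
    destruct (level_bot_top _ _ Hm). }
  destruct (proj1 (level_arr _ _ _ _ _) H false I _ _ (tracks_arr _ _ _ _ H1))
    as (p & p' & _ & _ & Hp).
  destruct (proj1 (level_arr _ _ _ _ _) Hp false I _ _ (tracks_arr _ _ _ _ H2))
    as (m & m' & _ & _ & Hm).
  exists m, m'; exact Hm.
- destruct (tracks_ret x x Id (tracks_id x) false n n' H) as (m & m' & _ & _ & Hm).
  exists m, m'; exact Hm.
Qed.

(** The implication of the modification is [u ~> j v], so that its combinators are programs
    of these shapes with [Ret] and [Bind] inserted. *)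
Lemma sep_modification_inf (X : ob -> Prop) c :
  (forall x, X x -> exists u v, x = u ~> v /\ tracks u c v) ->
  sep (modification PER_K1) (inf X).
Proof. intros H; apply sep_nucleus, sep_cat_inf with c, H. Qed.

Lemma modification_algebra : is_arrow_algebra (modification PER_K1).
Proof.
repeat split.
- intros x y H (n & n' & Hx).
  exists n, n'; exact (proj1 (mod_nucleus_mono PER_K1 x y H) n n' Hx).
- intros a b Hab Ha; pose (x := a : ob); pose (y := b : ob).
  destruct (proj1 (sep_nucleus (x ~> j y)) Hab) as (r & r' & Hr).
  destruct (proj1 (sep_nucleus x) Ha) as (n & n' & Hn).
  destruct (proj1 (level_arr x (j y) false r r') Hr false I n n' Hn) as (m & m' & _ & _ & Hm).
  exists m, m'; exact Hm.
- apply sep_modification_inf with (Ret (Lam (Ret Left))); intros x (a & b & ->).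
  do 2 eexists; split; [reflexivity|].
  apply tracks_ret, tracks_lam, tracks_ret, tracks_left.
- (* The context is ((x, y), z): run x z to get a function, then y z, then apply. *)
  apply sep_modification_inf with
    (Ret (Lam (Ret (Lam (Bind (App (Comp Left Left) Right)
       (Bind (Comp (App (Comp Right Left) Right) Left)
          (App (Comp Right Left) Right))))))).
  intros x (a & b & c & ->); do 2 eexists; split; [reflexivity|].
  apply tracks_ret, tracks_lam, tracks_ret, tracks_lam.
  eapply tracks_bind.
  { eapply tracks_app; [apply tracks_skip, tracks_left|apply tracks_right]. }
  eapply tracks_bind.
  { apply tracks_skip; eapply tracks_app; [apply tracks_skip, tracks_right|apply tracks_right]. }
  eapply tracks_app; [apply tracks_skip, tracks_right|apply tracks_right].
- (* As members of [B] have the form [c ~> j d], running x y inside the last abstraction,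
     once an argument z in [c] is given, leaves a total closure even if [B] is empty. *)
  apply sep_modification_inf with
    (Ret (Lam (Ret (Lam (Bind (App (Comp Left Left) (Comp Right Left))
       (App Right (Comp Right Left))))))).
  intros x (a & B & HB & ->); do 2 eexists; split; [reflexivity|].
  apply tracks_ret, tracks_lam, tracks_ret, tracks_lam_inf; intros b Hb.
  destruct (HB b Hb) as (c & d & ->); do 2 eexists; split; [reflexivity|].
  eapply tracks_bind.
  { eapply tracks_app; [|apply tracks_skip, tracks_right].
    eapply tracks_sub; [apply tracks_skip, tracks_left|].
    apply (@inf_lb (arrow_cat PER_K1)); exists (@arr (modification PER_K1) c d).
    split; [exact Hb|reflexivity]. }
  eapply tracks_app; [apply tracks_right|apply tracks_skip, tracks_right].
Qed.

(** * Sums and unions *)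

(** [pr a 0] is the left injection of [a], and [pr a t] with [t] positive a right one. *)
Definition rel_sum (R S : relation nat) : relation nat :=
  fun n n' => match rgt n, rgt n' with
              | 0, 0 => R (lft n) (lft n')
              | Datatypes.S _, Datatypes.S _ => S (lft n) (lft n')
              | _, _ => False
              end.

Lemma rel_sum_per (R S : per) : is_per (rel_sum R S).
Proof.
unfold rel_sum; split.
- intros n n'; destruct (rgt n), (rgt n'); auto using per_sym.
- intros n m p; destruct (rgt n), (rgt m), (rgt p); try easy; apply per_trans.
Qed.

Definition sum (x y : ob) : ob.
Proof.
refine (ob_intro (fun w => exist _ _ (rel_sum_per (level x w) (level y w))) _).
abstract (intros n n'; cbn; unfold rel_sum;
  destruct (rgt n), (rgt n'); auto; apply (level_mono _ false true); exact I).
Defined.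

Lemma level_sum (x y : ob) w n n' :
  level (sum x y) w n n' <-> rel_sum (level x w) (level y w) n n'.
Proof. destruct w; reflexivity. Qed.

Lemma tracks_inl (x y : ob) : tracks x (Pair Id Zero) (sum x y).
Proof.
intros w n n' Hn; exists (pr n 0), (pr n' 0).
repeat split; try (apply eval_Pair; [apply eval_Id|reflexivity]).
apply level_sum; unfold rel_sum; rewrite !rgt_pr, !lft_pr; exact Hn.
Qed.

Lemma tracks_inr (x y : ob) : tracks y (Pair Id (Const 1)) (sum x y).
Proof.
intros w n n' Hn; exists (pr n 1), (pr n' 1).
repeat split; try (apply eval_Pair; [apply eval_Id|apply eval_Const]).
apply level_sum; unfold rel_sum; rewrite !rgt_pr, !lft_pr; exact Hn.
Qed.

Lemma tracks_case (x y z : ob) c d :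
  tracks x c z -> tracks y d z -> tracks (sum x y) (Case c d) z.
Proof.
intros Hc Hd w n n' Hn; apply level_sum in Hn; unfold rel_sum in Hn.
pose proof (eval_Case c d n) as En; pose proof (eval_Case c d n') as En'.
destruct (rgt n), (rgt n'); try easy.
- destruct (Hc w _ _ Hn) as (m & m' & Hm & Hm' & Hz); exists m, m'; auto.
- destruct (Hd w _ _ Hn) as (m & m' & Hm & Hm' & Hz); exists m, m'; auto.
Qed.

Lemma sum_mono (x y y' : ob) : y =< y' -> sum x y =< sum x y'.
Proof.
intros H; apply le_level; intros w n n'; rewrite !level_sum; unfold rel_sum.
destruct (rgt n), (rgt n'); auto; apply le_level; exact H.
Qed.

Lemma pull_per c (R : per) :
  is_per (fun n n' => exists m m', eval c n m /\ eval c n' m' /\ R m m').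
Proof.
split.
- intros n n' (m & m' & Hm & Hm' & H); exists m', m; auto using per_sym.
- intros n n' n'' (m & m' & Hm & Hm' & H) (p & p' & Hp & Hp' & K).
  exists m, p'; repeat split; auto; apply per_trans with m'; [exact H|].
  rewrite (eval_det _ _ _ _ Hm' Hp); exact K.
Qed.

(** The largest type that [c] tracks to [y]; it turns tracking into an inclusion, and hence
    gives the elimination rule [tracks_sup] for unions. *)
Definition pull (c : code) (y : ob) : ob.
Proof.
refine (ob_intro (fun w => exist _ _ (pull_per c (level y w))) _).
abstract (intros n n' (m & m' & Hm & Hm' & H); exists m, m'; repeat split; auto;
          apply (level_mono _ false true); simpl; auto).
Defined.

Lemma tracks_pull (x : ob) c y : tracks x c y <-> x =< pull c y.
Proof.
rewrite le_level; split; intros H [|] n n' Hn; exact (H _ n n' Hn).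
Qed.

Lemma inf_antitone {A : arrow_structure} (X Y : A -> Prop) :
  (forall x, Y x -> X x) -> inf X =< inf Y.
Proof. intros H; apply inf_mono; intros x Hx; exists x; auto using ale_refl. Qed.

(** The least upper bound: at each level, the partial equivalence relation generated
    by the union. *)
Definition sup (X : ob -> Prop) : ob := inf (fun u => forall x, X x -> x =< u).

Lemma sup_ub (X : ob -> Prop) x : X x -> x =< sup X.
Proof. intros Hx; apply inf_greatest; auto. Qed.

Lemma sup_mono (X Y : ob -> Prop) : (forall x, X x -> Y x) -> sup X =< sup Y.
Proof. intros H; apply inf_antitone; intros u Hu x Hx; auto. Qed.

Lemma tracks_sup (X : ob -> Prop) c y :
  (forall x, X x -> tracks x c y) -> tracks (sup X) c y.
Proof.
intros H; apply tracks_pull, inf_lb; intros x Hx; apply tracks_pull; auto.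
Qed.

Lemma tracks_top (x : ob) c f : (forall n, eval c n (f n)) -> tracks x c top.
Proof.
intros H w n n' _; exists (f n), (f n'); repeat split; auto.
apply level_inf; intros _ [].
Qed.

(** * Pointed types *)

Definition pointed (x : ob) : Prop := level x true 0 0.

Lemma pointed_top : pointed top.
Proof. apply level_inf; intros _ []. Qed.

Lemma pointed_bot_top : pointed bot_top.
Proof. intros R []. Qed.

Lemma pointed_prod (x y : ob) : pointed x -> pointed y -> pointed (prod x y).
Proof. intros Hx Hy; apply level_prod; rewrite lft_0, rgt_0; auto. Qed.

(** [0] is the left injection of [0]. *)
Lemma pointed_sum (x y : ob) : pointed x -> pointed (sum x y).
Proof. intros Hx; apply level_sum; unfold rel_sum; rewrite rgt_0, lft_0; exact Hx. Qed.

(** [0] is the index of [Zero], the constant function [0]. *)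
Lemma pointed_arr (x y : ob) : pointed y -> pointed (x ~> y).
Proof.
intros Hy; apply level_arr; intros [|] Hv; [|discriminate]; intros n n' _.
exists 0, 0; rewrite <- encode_Zero at 1 3.
repeat split; try (apply app_encode; reflexivity); exact Hy.
Qed.

Lemma pointed_inf (X : ob -> Prop) : (forall x, X x -> pointed x) -> pointed (inf X).
Proof. intros H; apply level_inf, H. Qed.

(** The type [bot_top] is empty at level [false], so a pointed target is reached by the
    constant [0]. *)
Lemma tracks_bot_top (x : ob) : pointed x -> tracks bot_top Zero x.
Proof.
intros Hx [|] n n' H; [exists 0, 0; repeat split; exact Hx|].
destruct (level_bot_top _ _ H).
Qed.

Definition obj (s : Sigma_T) : ob :=
  exist (fun x : PER_K1 * PER_K1 => fst x =< snd x) (proj1_sig s) (proj1 (proj2_sig s)).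

Definition point (x : ob) (H : pointed x) : Sigma_T :=
  exist _ (proj1_sig x) (conj (proj2_sig x) H).

Lemma obj_point x H : obj (point x H) = x.
Proof. destruct x as [p Hp]; apply (f_equal (exist _ p)), proof_irrelevance. Qed.

Lemma pointed_obj s : pointed (obj s).
Proof. apply (proj2_sig s). Qed.

(** The two conditions in the order of [T] amount to [(r, r)] lying in the implication of
    pairs at level [false]. *)
Lemma T_le {I : Type} (a b : T I) :
  ile a b <-> exists c, forall i, tracks (obj (a i)) c (obj (b i)).
Proof.
assert (E : forall r i,
  level (obj (a i) ~> obj (b i)) false r r <->
  per_arr (fst (proj1_sig (a i))) (fst (proj1_sig (b i))) r r /\
  per_arr (snd (proj1_sig (a i))) (snd (proj1_sig (b i))) r r).
{ intros r i; split.
  - intros H; split; apply H; auto.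
  - intros [H0 H1] R [->| ->]; assumption. }
split.
- intros (r & H); exists (App (Const r) Id); intros i.
  apply tracks_index, E, H.
- intros (c & H); exists (encode c); intros i; apply E, tracks_arr, H.
Qed.

(** * Heyting structure along correspondences of preorders *)

(** A relation that matches the two orders and is onto carries every universal property
    over.  It is used both for the isomorphism relation of a single preorder and for an
    equivalence of preorders. *)
Section Correspondence.
Context {X Y : Type} (leX : relation X) (leY : relation Y) (E : X -> Y -> Prop).
Context (E_le : forall x y x' y', E x y -> E x' y' -> leX x x' <-> leY y y').
Context (E_onto : forall y, exists x, E x y).

Lemma corr_top x y : E x y -> is_top leX x -> is_top leY y.
Proof.
intros H Hx z; destruct (E_onto z) as (w & Hw).
apply (E_le _ _ _ _ Hw H), Hx.
Qed.

Lemma corr_bot x y : E x y -> is_bot leX x -> is_bot leY y.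
Proof.
intros H Hx z; destruct (E_onto z) as (w & Hw).
apply (E_le _ _ _ _ H Hw), Hx.
Qed.

Lemma corr_meet x y x' y' m n :
  E x y -> E x' y' -> E m n -> is_meet leX x x' m -> is_meet leY y y' n.
Proof.
intros H H' Hm M z; destruct (E_onto z) as (w & Hw).
rewrite <- (E_le _ _ _ _ Hw H), <- (E_le _ _ _ _ Hw H'), <- (E_le _ _ _ _ Hw Hm).
apply M.
Qed.

Lemma corr_join x y x' y' m n :
  E x y -> E x' y' -> E m n -> is_join leX x x' m -> is_join leY y y' n.
Proof.
intros H H' Hm M z; destruct (E_onto z) as (w & Hw).
rewrite <- (E_le _ _ _ _ H Hw), <- (E_le _ _ _ _ H' Hw), <- (E_le _ _ _ _ Hm Hw).
apply M.
Qed.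
End Correspondence.

(** Implications are tested on meets of the target, which have to be matched in the source,
    so here the relation is total as well. *)
Lemma corr_imp {X Y : Type} (leX : relation X) (leY : relation Y) (E : X -> Y -> Prop)
    (E_le : forall x y x' y', E x y -> E x' y' -> leX x x' <-> leY y y')
    (E_onto : forall y, exists x, E x y) (E_total : forall x, exists y, E x y)
    x y x' y' e f :
  E x y -> E x' y' -> E e f -> is_imp leX x x' e -> is_imp leY y y' f.
Proof.
intros H H' He M z n Hn; destruct (E_onto z) as (w & Hw), (E_onto n) as (m & Hm).
rewrite <- (E_le _ _ _ _ Hw He), <- (E_le _ _ _ _ Hm H').
apply M; revert Hn.
apply (corr_meet leY leX (fun y x => E x y)); auto.
intros a b a' b' Hb Hb'; symmetry; apply E_le; assumption.
Qed.

Section Iso.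
Context {X : Type} {le : relation X} (le_pre : preorder X le).

Lemma iso_refl x : iso le x x.
Proof. split; apply (preord_refl _ _ le_pre). Qed.

Lemma iso_trans x y z : iso le x y -> iso le y z -> iso le x z.
Proof. intros [] []; split; eapply (preord_trans _ _ le_pre); eassumption. Qed.

Lemma iso_le x y x' y' : iso le x y -> iso le x' y' -> le x x' <-> le y y'.
Proof.
pose proof (preord_trans _ _ le_pre) as Tr.
intros [H K] [H' K']; split; intros L.
- apply Tr with x; [exact K|]; apply Tr with x'; assumption.
- apply Tr with y; [exact H|]; apply Tr with y'; assumption.
Qed.

Lemma iso_onto y : exists x, iso le x y.
Proof. exists y; apply iso_refl. Qed.

Lemma top_unique t t' : is_top le t -> is_top le t' -> iso le t t'.
Proof. intros H H'; split; [apply H'|apply H]. Qed.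

Lemma bot_unique b b' : is_bot le b -> is_bot le b' -> iso le b b'.
Proof. intros H H'; split; [apply H|apply H']. Qed.

Lemma meet_unique x y m m' : is_meet le x y m -> is_meet le x y m' -> iso le m m'.
Proof.
intros H H'; split; [apply H', H|apply H, H']; apply (preord_refl _ _ le_pre).
Qed.

Lemma join_unique x y m m' : is_join le x y m -> is_join le x y m' -> iso le m m'.
Proof.
intros H H'; split; [apply H, H'|apply H', H]; apply (preord_refl _ _ le_pre).
Qed.

Lemma imp_unique (has_meets : forall x y, exists m, is_meet le x y m) x y e e' :
  is_imp le x y e -> is_imp le x y e' -> iso le e e'.
Proof.
intros H H'; split.
- destruct (has_meets e x) as (m & Hm).
  apply (H' _ _ Hm), (H _ _ Hm), (preord_refl _ _ le_pre).
- destruct (has_meets e' x) as (m & Hm).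
  apply (H _ _ Hm), (H' _ _ Hm), (preord_refl _ _ le_pre).
Qed.
End Iso.

(** * Heyting operations *)

Definition heyting_operations {X : Type} (le : relation X) (t b : X) (m s e : X -> X -> X) :=
  is_top le t /\ is_bot le b /\ (forall x y, is_meet le x y (m x y)) /\
  (forall x y, is_join le x y (s x y)) /\ (forall x y, is_imp le x y (e x y)).

Lemma heyting_operations_preheyting {X : Type} (le : relation X) t b m s e :
  preorder X le -> heyting_operations le t b m s e -> is_preheyting le.
Proof. intros H (Ht & Hb & Hm & Hs & He); repeat split; eauto; apply H. Qed.

(** The given operations are preserved on the nose, and any other top, bottom, meet, join or
    implication is isomorphic to the given one. *)
Lemma heyting_operations_map {X Y : Type} (leX : relation X) (leY : relation Y) f
    t b m s e t' b' m' s' e' :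
  preorder X leX -> preorder Y leY -> monotone leX leY f ->
  heyting_operations leX t b m s e -> heyting_operations leY t' b' m' s' e' ->
  f t = t' -> f b = b' -> (forall x y, f (m x y) = m' (f x) (f y)) ->
  (forall x y, f (s x y) = s' (f x) (f y)) -> (forall x y, f (e x y) = e' (f x) (f y)) ->
  is_preheyting_map leX leY f.
Proof.
intros HX HY Hf (Ht & Hb & Hm & Hs & He) (Ht' & Hb' & Hm' & Hs' & He') Et Eb Em Es Ee.
assert (F : forall x x', iso leX x x' -> iso leY (f x) (f x'))
  by (intros x x' []; split; apply Hf; assumption).
pose proof (@iso_le _ _ HY) as E; pose proof (@iso_onto _ _ HY) as O.
pose proof (@iso_refl _ _ HY) as R.
assert (O' : forall x, exists y, iso leY x y) by (intros x; exists x; apply R).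
split; [exact Hf|]; split; [|split; [|split; [|split]]].
- intros u Hu; apply (corr_top _ _ _ E O (f t)); [apply F, top_unique; auto|].
  rewrite Et; exact Ht'.
- intros u Hu; apply (corr_bot _ _ _ E O (f b)); [apply F, bot_unique; auto|].
  rewrite Eb; exact Hb'.
- intros x y u Hu; apply (corr_meet _ _ _ E O (f x) _ (f y) _ (f (m x y))); auto;
    [apply F; apply (meet_unique HX) with x y; auto|rewrite Em; apply Hm'].
- intros x y u Hu; apply (corr_join _ _ _ E O (f x) _ (f y) _ (f (s x y))); auto;
    [apply F; apply (join_unique HX) with x y; auto|rewrite Es; apply Hs'].
- intros x y u Hu; apply (corr_imp _ _ _ E O O' (f x) _ (f y) _ (f (e x y))); auto;
    [apply F; apply (imp_unique HX) with x y; eauto|rewrite Ee; apply He'].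
Qed.

(** * The tripos structure of T *)

Definition T_top {I : Type} : T I := fun _ => point top pointed_top.
Definition T_bot {I : Type} : T I := fun _ => point bot_top pointed_bot_top.

Definition T_meet {I : Type} (a b : T I) : T I :=
  fun i => point (prod (obj (a i)) (obj (b i)))
             (pointed_prod _ _ (pointed_obj (a i)) (pointed_obj (b i))).

Definition T_join {I : Type} (a b : T I) : T I :=
  fun i => point (sum (obj (a i)) (obj (b i))) (pointed_sum _ _ (pointed_obj (a i))).

Definition T_imp {I : Type} (a b : T I) : T I :=
  fun i => point (obj (a i) ~> obj (b i)) (pointed_arr _ _ (pointed_obj (b i))).

Definition fibre {I J : Type} (f : I -> J) (a : T I) (F : ob -> ob) (k : J) : ob -> Prop :=
  fun x => exists i, f i = k /\ x = F (obj (a i)).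

(** The union needs a point, and over a [k] outside the image of [f], where it is empty, a
    realiser of the fibres may diverge on [0].  The summand [bot_top] supplies the point and
    is sent to [0] without running that realiser. *)
Definition T_ex (I J : Type) (f : I -> J) (a : T I) : T J :=
  fun k => point (sum bot_top (sup (fibre f a (fun x => x) k)))
             (pointed_sum _ _ pointed_bot_top).

Lemma pointed_all {I J : Type} (f : I -> J) (a : T I) k :
  pointed (inf (fibre f a (fun x => top ~> x) k)).
Proof. apply pointed_inf; intros x (i & _ & ->); apply pointed_arr, pointed_obj. Qed.

(** Each member is guarded by [top ~> x], and so is an implication: a realiser of [x] itself
    might diverge over a [k] with empty fibre, a suspended one does not. *)
Definition T_all (I J : Type) (f : I -> J) (a : T I) : T J :=
  fun k => point (inf (fibre f a (fun x => top ~> x) k)) (pointed_all f a k).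

Lemma T_preorder I : preorder (T I) ile.
Proof.
split.
- intros a; apply T_le; exists Id; intros i; apply tracks_id.
- intros a b c H K; apply T_le in H, K; destruct H as (d & H), K as (e & K).
  apply T_le; exists (Comp e d); intros i; eapply tracks_comp; eauto.
Qed.

Lemma T_heyting I :
  heyting_operations (ile : relation (T I)) T_top T_bot T_meet T_join T_imp.
Proof.
assert (meet : forall a b : T I, is_meet ile a b (T_meet a b)).
{ intros a b c; rewrite !T_le; split.
  - intros (d & H); split; [exists (Comp Left d)|exists (Comp Right d)]; intros i;
      specialize (H i); unfold T_meet in H; rewrite obj_point in H;
      eapply tracks_comp; eauto using tracks_left, tracks_right.
  - intros [(d & H) (e & K)]; exists (Pair d e); intros i; unfold T_meet; rewrite obj_point.
    apply tracks_pair; auto. }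
split; [|split; [|split; [exact meet|split]]].
- intros a; apply T_le; exists Id; intros i; unfold T_top; rewrite obj_point.
  apply tracks_top with (fun n => n), eval_Id.
- intros a; apply T_le; exists Zero; intros i; unfold T_bot; rewrite obj_point.
  apply tracks_bot_top, pointed_obj.
- intros a b c; rewrite !T_le; split.
  + intros (d & H); split; [exists (Comp d (Pair Id Zero))|exists (Comp d (Pair Id (Const 1)))];
      intros i; specialize (H i); unfold T_join in H; rewrite obj_point in H;
      eapply tracks_comp; eauto using tracks_inl, tracks_inr.
  + intros [(d & H) (e & K)]; exists (Case d e); intros i; unfold T_join; rewrite obj_point.
    apply tracks_case; auto.
- intros a b c m Hm.
  assert (E : iso ile m (T_meet c a)) by (apply (meet_unique (T_preorder I)) with c a; auto).
  rewrite (iso_le (T_preorder I) _ _ _ _ E (iso_refl (T_preorder I) b)), !T_le.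
  split.
  + intros (d & H); exists (App (Comp d Left) Right); intros i; specialize (H i).
    unfold T_imp in H; unfold T_meet; rewrite obj_point in *.
    eapply tracks_app; [apply tracks_skip, H|apply tracks_right].
  + intros (d & H); exists (Lam d); intros i; specialize (H i).
    unfold T_meet in H; unfold T_imp; rewrite obj_point in *.
    apply tracks_lam, H.
Qed.

Lemma T_indexed_preorder : is_indexed_preorder T.
Proof.
split; [apply T_preorder|split; [|split]].
- intros I J f a b H; apply T_le in H; destruct H as (c & H).
  apply T_le; exists c; intros i; apply H.
- intros I a; apply iso_refl, T_preorder.
- intros I J K f g a; apply iso_refl, T_preorder.
Qed.

Lemma T_ex_left_adjoint I J (f : I -> J) : is_left_adjoint T f (T_ex I J f).
Proof.
intros a b; rewrite !T_le; split.
- intros (c & H); exists (Comp c (Pair Id (Const 1))); intros i; specialize (H (f i)).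
  unfold T_ex in H; rewrite obj_point in H.
  eapply tracks_comp; [|exact H].
  eapply tracks_sub; [apply tracks_inr|]; apply sum_mono, sup_ub; exists i; auto.
- intros (c & H); exists (Case Zero c); intros k; unfold T_ex; rewrite obj_point.
  apply tracks_case; [apply tracks_bot_top, pointed_obj|].
  apply tracks_sup; intros x (i & <- & ->); apply H.
Qed.

Lemma T_all_right_adjoint I J (f : I -> J) : is_right_adjoint T f (T_all I J f).
Proof.
intros a b; rewrite !T_le; split.
- intros (c & H); exists (App c Zero); intros i; specialize (H (f i)).
  unfold T_all in H; rewrite obj_point in H.
  apply tracks_app with top; [|apply tracks_top with (fun _ => 0); reflexivity].
  eapply tracks_sub; [apply H|]; apply inf_lb; exists i; auto.
- intros (c & H); exists (Lam (Comp c Left)); intros k; unfold T_all; rewrite obj_point.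
  apply tracks_lam_inf; intros x (i & <- & ->); do 2 eexists; split; [reflexivity|].
  apply tracks_skip, H.
Qed.

(** The Beck-Chevalley conditions hold with identity realisers, because in a pullback square
    the two families of types that are united or intersected are the same. *)
Lemma fibre_pullback {W X Y Z : Type} (p : W -> X) (q : W -> Y) (f : X -> Z) (g : Y -> Z)
    (a : T Y) F x u :
  is_pullback p q f g -> fibre g a F (f x) u <-> fibre p (reindex T q a) F x u.
Proof.
intros [Hc Hu]; split.
- intros (y & Hy & ->); destruct (Hu x y (eq_sym Hy)) as (w & (Hp & Hq) & _).
  exists w; subst; auto.
- intros (w & <- & ->); exists (q w); auto.
Qed.

Lemma T_le_pointwise {I : Type} (a b : T I) : (forall i, obj (a i) =< obj (b i)) -> ile a b.
Proof. intros H; apply T_le; exists Id; intros i; apply tracks_le, H. Qed.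

Lemma T_tripos : is_tripos T.
Proof.
split; [exact T_indexed_preorder|split; [|split; [|split; [|split]]]].
- intros I; eapply heyting_operations_preheyting; [apply T_preorder|apply T_heyting].
- intros I J f.
  eapply heyting_operations_map; try apply T_preorder; try apply T_heyting; try reflexivity.
  apply T_indexed_preorder.
- exists T_ex; split; [exact T_ex_left_adjoint|].
  intros W X Y Z p q f g H a; split; apply T_le_pointwise; intros x; cbn; unfold T_ex;
    rewrite !obj_point; apply sum_mono, sup_mono; intros u Hu;
    apply (fibre_pullback p q f g a _ x u H); exact Hu.
- exists T_all; split; [exact T_all_right_adjoint|].
  intros W X Y Z p q f g H a; split; apply T_le_pointwise; intros x; cbn; unfold T_all;
    rewrite !obj_point; apply (inf_antitone (A := arrow_cat PER_K1)); intros u Hu;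
    apply (fibre_pullback p q f g a _ x u H); exact Hu.
- exists Sigma_T, (fun s => s); intros I a; exists a; apply iso_refl, T_preorder.
Qed.

(** * The equivalence *)

Local Notation M := (induced_tripos (modification PER_K1)).

(** The outer [j] in the separator of the modification is removed by [sep_nucleus]. *)
Lemma M_le {I : Type} (a b : M I) :
  ile a b <-> exists c, forall i, tracks (a i) c (j (b i)).
Proof.
split.
- intros H; apply (sep_nucleus (inf_fam (fun i => (a i : ob) ~> j (b i)))) in H.
  destruct H as (r & r' & H); exists (App (Const r) Id); intros i; apply tracks_index.
  change (level (inf_fam (fun i => (a i : ob) ~> j (b i))) false r r') in H.
  apply (proj1 (level_inf _ false r r')) with (x := (a i : ob) ~> j (b i)) in H;
    [|exists i; auto].
  apply per_trans with r'; [|apply per_sym]; exact H.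
- intros (c & H).
  apply (sep_modification_inf _ c); intros x (i & ->); do 2 eexists; split; [reflexivity|].
  apply H.
Qed.

(** Calls a program for [j x] with the two injections as continuations; the
    second answers [0], the left injection of [0]. *)
Definition to_sum : code :=
  App (App Id (Lam (Comp (Pair Id (Const 1)) Right))) (Lam (Comp Zero Right)).

Lemma tracks_to_sum (x : ob) : tracks (j x) to_sum (sum bot_top x).
Proof.
eapply tracks_app; [eapply tracks_app|].
- apply tracks_le, j_elim.
- apply tracks_lam; eapply tracks_comp; [apply tracks_right|apply tracks_inr].
- apply tracks_lam; eapply tracks_comp; [apply tracks_right|].
  apply tracks_bot_top, pointed_sum, pointed_bot_top.
Qed.

(** On the left summand, an element of [bot_top], calls the second continuation. *)
Definition of_sum : code := Case (Lam (Lam (App Right (Comp Left Left)))) (Ret Id).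

Lemma tracks_of_sum (x : ob) : tracks (sum bot_top x) of_sum (j x).
Proof.
apply tracks_case; [|apply tracks_ret, tracks_id].
apply tracks_lam_inf; intros u (z & ->); do 2 eexists; split; [reflexivity|].
apply tracks_lam; eapply tracks_app; [apply tracks_right|].
apply tracks_skip, tracks_left.
Qed.

Definition M_to_T (I : Type) (a : M I) : T I :=
  fun i => point (sum bot_top (a i)) (pointed_sum _ _ pointed_bot_top).

Definition T_to_M (I : Type) (a : T I) : M I := fun i => obj (a i).

Lemma tracks_force (x : ob) : pointed x -> tracks (sum bot_top x) (Case Zero Id) x.
Proof. intros Hx; apply tracks_case; [apply tracks_bot_top, Hx|apply tracks_id]. Qed.

Lemma M_preorder I : preorder (M I) ile.
Proof.
split.
- intros a; apply M_le; exists (Ret Id); intros i; apply tracks_ret, tracks_id.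
- intros a b c H K; apply M_le in H, K; destruct H as (d & H), K as (e & K).
  apply M_le; exists (Bind d (Comp e Right)); intros i; eapply tracks_bind; [apply H|].
  eapply tracks_comp; [apply tracks_right|apply K].
Qed.

Lemma M_indexed_preorder : is_indexed_preorder M.
Proof.
split; [apply M_preorder|split; [|split]].
- intros I J f a b H; apply M_le in H; destruct H as (c & H).
  apply M_le; exists c; intros i; apply H.
- intros I a; apply iso_refl, M_preorder.
- intros I J K f g a; apply iso_refl, M_preorder.
Qed.

Lemma T_M_equivalent : indexed_equivalent T M.
Proof.
exists T_to_M, M_to_T; split; [|split; [|split]].
- split.
  + intros I a b H; apply T_le in H; destruct H as (c & H).
    apply M_le; exists (Ret c); intros i; apply tracks_ret, H.
  + intros I J f a; apply iso_refl, M_preorder.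
- split.
  + intros I a b H; apply M_le in H; destruct H as (c & H).
    apply T_le; exists (Case (Pair Id Zero) (Comp to_sum c)); intros i.
    unfold M_to_T; rewrite !obj_point; apply tracks_case; [apply tracks_inl|].
    eapply tracks_comp; [apply H|apply tracks_to_sum].
  + intros I J f a; apply iso_refl, T_preorder.
- intros I a; split; apply T_le.
  + exists (Case Zero Id); intros i; unfold M_to_T; rewrite obj_point.
    apply tracks_force, pointed_obj.
  + exists (Pair Id (Const 1)); intros i; unfold M_to_T; rewrite obj_point.
    apply tracks_inr.
- intros I a; split; apply M_le.
  + exists of_sum; intros i; unfold T_to_M, M_to_T; rewrite obj_point.
    apply tracks_of_sum.
  + exists (Ret (Pair Id (Const 1))); intros i; unfold T_to_M, M_to_T; rewrite obj_point.
    apply tracks_ret, tracks_inr.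
Qed.

(** * Transfer of tripos structure along an equivalence *)

Section Transfer.
Context (P Q : indexed_data) (F : forall I, P I -> Q I) (G : forall I, Q I -> P I).
Context (HP : is_indexed_preorder P) (HQ : is_indexed_preorder Q).
Context (HF : is_pseudonatural P Q F) (HG : is_pseudonatural Q P G).
Context (GF : forall I (x : P I), iso ile (G I (F I x)) x).
Context (FG : forall I (y : Q I), iso ile (F I (G I y)) y).

(** Fibrewise matching along [F], stable under reindexing: universal properties are carried
    from [P] to [Q] through it, and back through its converse. *)
Definition linked (I : Type) (x : P I) (y : Q I) : Prop := iso ile (F I x) y.

Lemma linked_F I x : linked I x (F I x).
Proof. apply iso_refl, HQ. Qed.

Lemma linked_G I y : linked I (G I y) y.
Proof. apply FG. Qed.

Lemma linked_le I x y x' y' : linked I x y -> linked I x' y' -> ile x x' <-> ile y y'.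
Proof.
destruct HP as [Pp _], HQ as [Qp _], HF as [Fm _], HG as [Gm _].
intros H H'; rewrite <- (iso_le (Qp I) _ _ _ _ H H'); split; [apply Fm|].
intros K; apply (iso_le (Pp I) _ _ _ _ (GF I x) (GF I x')), Gm, K.
Qed.

Lemma linked_iso I x y x' y' :
  linked I x y -> linked I x' y' -> iso ile x x' -> iso ile y y'.
Proof.
intros H H' [K K']; split;
  [apply (linked_le I x y x' y')|apply (linked_le I x' y' x y)]; assumption.
Qed.

Lemma linked_reindex I J (f : I -> J) x y :
  linked J x y -> linked I (reindex P f x) (reindex Q f y).
Proof.
destruct HQ as (Qp & Qm & _), HF as [_ Fn]; intros [H H'].
apply (iso_trans (Qp I)) with (reindex Q f (F J x)); [apply Fn|split; apply Qm; assumption].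
Qed.

Lemma linked_onto I y : exists x, linked I x y.
Proof. exists (G I y); apply linked_G. Qed.

Lemma linked_total I x : exists y, linked I x y.
Proof. exists (F I x); apply linked_F. Qed.

Lemma transfer_preheyting I :
  is_preheyting (ile : relation (P I)) -> is_preheyting (ile : relation (Q I)).
Proof.
pose proof (linked_le I) as L; pose proof (linked_onto I) as O.
pose proof (linked_total I) as O'.
pose proof (linked_F I) as EF; pose proof (linked_G I) as EG.
intros (_ & (t & Ht) & (b & Hb) & Hm & Hs & He).
split; [apply HQ|split; [|split; [|split; [|split]]]].
- exists (F I t); exact (corr_top _ _ _ L O _ _ (EF t) Ht).
- exists (F I b); exact (corr_bot _ _ _ L O _ _ (EF b) Hb).
- intros x y; destruct (Hm (G I x) (G I y)) as (m & K).
  exists (F I m); eapply (corr_meet _ _ _ L O); eauto.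
- intros x y; destruct (Hs (G I x) (G I y)) as (m & K).
  exists (F I m); eapply (corr_join _ _ _ L O); eauto.
- intros x y; destruct (He (G I x) (G I y)) as (m & K).
  exists (F I m); eapply (corr_imp _ _ _ L O O'); eauto.
Qed.

Lemma transfer_preheyting_map I J (f : I -> J) :
  is_preheyting_map ile ile (reindex P f) -> is_preheyting_map ile ile (reindex Q f).
Proof.
assert (L : forall I y x y' x', linked I x y -> linked I x' y' -> ile y y' <-> ile x x').
{ intros; symmetry; apply linked_le; assumption. }
intros (_ & Ht & Hb & Hm & Hs & He).
split; [apply HQ|split; [|split; [|split; [|split]]]].
- intros t H; apply (corr_top _ _ _ (linked_le I) (linked_onto I) (reindex P f (G J t)));
    [apply linked_reindex, linked_G|apply Ht].
  apply (corr_top _ _ (fun y x => linked J x y) (L J) (linked_total J) t);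
    [apply linked_G|exact H].
- intros t H; apply (corr_bot _ _ _ (linked_le I) (linked_onto I) (reindex P f (G J t)));
    [apply linked_reindex, linked_G|apply Hb].
  apply (corr_bot _ _ (fun y x => linked J x y) (L J) (linked_total J) t);
    [apply linked_G|exact H].
- intros x y m H.
  eapply (corr_meet _ _ _ (linked_le I) (linked_onto I));
    [apply linked_reindex, linked_G..|apply Hm].
  eapply (corr_meet _ _ (fun y x => linked J x y) (L J) (linked_total J));
    [apply linked_G..|exact H].
- intros x y m H.
  eapply (corr_join _ _ _ (linked_le I) (linked_onto I));
    [apply linked_reindex, linked_G..|apply Hs].
  eapply (corr_join _ _ (fun y x => linked J x y) (L J) (linked_total J));
    [apply linked_G..|exact H].
- intros x y m H.
  eapply (corr_imp _ _ _ (linked_le I) (linked_onto I) (linked_total I));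
    [apply linked_reindex, linked_G..|apply He].
  eapply (corr_imp _ _ (fun y x => linked J x y) (L J) (linked_total J) (linked_onto J));
    [apply linked_G..|exact H].
Qed.

(** Adjoints are transported by conjugation with [F] and [G].  Both sides of the condition
    are linked to the corresponding sides in [P], except that [G] and reindexing have to be
    exchanged, which costs the monotonicity of [q]. *)
Lemma transfer_beck_chevalley (q : forall I J, (I -> J) -> P I -> P J) :
  (forall I J (f : I -> J), monotone ile ile (q I J f)) ->
  beck_chevalley P q ->
  beck_chevalley Q (fun I J f y => F J (q I J f (G I y))).
Proof.
intros Hq BC W X Y Z p r f g H y.
apply linked_iso with (reindex P f (q Y Z g (G Y y))) (q W X p (G W (reindex Q r y)));
  [apply linked_reindex, linked_F|apply linked_F|].
apply (iso_trans (proj1 HP X)) with (q W X p (reindex P r (G Y y))); [apply BC, H|].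
split; apply Hq; apply (linked_le W _ (reindex Q r y) _ (reindex Q r y));
  try apply linked_reindex; try apply linked_G; apply (preord_refl _ _ (proj1 HQ W)).
Qed.

Lemma transfer_tripos : is_tripos P -> is_tripos Q.
Proof.
intros (_ & Hh & Hm & (ex & Hex & BCex) & (all & Hall & BCall) & (S & s & Hs)).
split; [exact HQ|split; [|split; [|split; [|split]]]].
- intros I; apply transfer_preheyting, Hh.
- intros I J f; apply transfer_preheyting_map, Hm.
- exists (fun I J f y => F J (ex I J f (G I y))); split.
  + intros I J f x y.
    apply (iff_trans (iff_sym (linked_le J _ _ _ _ (linked_F J _) (linked_G J y)))).
    apply (iff_trans (Hex I J f _ _)).
    apply linked_le; [apply linked_G|apply linked_reindex, linked_G].
  + apply transfer_beck_chevalley; [|exact BCex].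
    intros I J f x x' H; apply Hex, (preord_trans _ _ (proj1 HP I)) with x'; [exact H|].
    apply Hex, (proj1 HP J).
- exists (fun I J f y => F J (all I J f (G I y))); split.
  + intros I J f x y.
    apply (iff_trans (iff_sym (linked_le J _ _ _ _ (linked_G J y) (linked_F J _)))).
    apply (iff_trans (Hall I J f _ _)).
    apply linked_le; [apply linked_reindex, linked_G|apply linked_G].
  + apply transfer_beck_chevalley; [|exact BCall].
    intros I J f x x' H; apply Hall, (preord_trans _ _ (proj1 HP I)) with x; [|exact H].
    apply Hall, (proj1 HP J).
- exists S, (F S s); intros I y; destruct (Hs I (G I y)) as (chi & H).
  exists chi; apply (linked_iso I (G I y) _ (reindex P chi s) _); [|apply linked_reindex|exact H].
  + apply linked_G.
  + apply linked_F.
Qed.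
End Transfer.

Theorem proposition7p10 :
  is_arrow_algebra PER_K1 /\ is_binary_implicative PER_K1 /\
  is_nucleus (arrow_cat PER_K1) (mod_nucleus PER_K1) /\
  is_arrow_algebra (modification PER_K1) /\
  is_tripos (induced_tripos (modification PER_K1)) /\
  indexed_equivalent T (induced_tripos (modification PER_K1)) /\
  is_tripos T.
Proof.
split; [exact PER_K1_algebra|].
split; [exact PER_K1_binary_implicative|].
split; [exact mod_nucleus_is_nucleus|].
split; [exact modification_algebra|].
split; [|exact (conj T_M_equivalent T_tripos)].
destruct T_M_equivalent as (F & G & HF & HG & GF & FG).
exact (transfer_tripos T M F G T_indexed_preorder M_indexed_preorder HF HG GF FG T_tripos).
Qed.
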